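(* Let $(A_\mu,B_\nu,\vartriangleright,\vartriangleleft,\rightharpoonup,\leftharpoonup,\theta)$ be a quasi-twilled associative algebra. Let $\mathfrak b=\bigoplus_{n\ge0}\mathfrak b_n$ with $\mathfrak b_n=\mathrm{Hom}(B^{\otimes n+1},A)$. Then $(\mathfrak b,\{l_k\}_{k=1}^\infty)$ is an $L_\infty$-algebra, where for $f,g,h\in\mathfrak b$, $$l_1(f)=[\nu_{\rightharpoonup,\leftharpoonup},f],\qquad l_2(f,g)=[[\mu_{\vartriangleright,\vartriangleleft},f],g],\qquad l_3(f,g,h)=[[[\widetilde\theta,f],g],h],\qquad l_k=0\ \text{ for }k\ge4.$$ Moreover, a linear map $r:B\to A$ is a weak deformation map if and only if $r\in\mathfrak b_0=\mathrm{Hom}(B,A)$ is a Maurer-Cartan element of this $L_\infty$-algebra.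
   Context: A quasi-twilled associative algebra is an associative algebra with a fixed vector space decomposition $\mathbb A=A\oplus B$ such that $B$ is a subalgebra. Its multiplication has the form $(a,x)\cdot_{\mathbb A}(b,y)=(a\cdot_A b+a\leftharpoonup y+x\rightharpoonup b,\ x\cdot_B y+a\vartriangleright y+x\vartriangleleft b+\theta(a,b))$ for unique bilinear maps $\mu=\cdot_A:A\times A\to A$, $\nu=\cdot_B:B\times B\to B$, $\vartriangleright:A\times B\to B$, $\vartriangleleft:B\times A\to B$, $\rightharpoonup:B\times A\to A$, $\leftharpoonup:A\times B\to A$, $\theta:A\times A\to B$; one writes it as the tuple $(A_\mu,B_\nu,\vartriangleright,\vartriangleleft,\rightharpoonup,\leftharpoonup,\theta)$. Put $\widetilde\theta((a,x),(b,y))=(0,\theta(a,b))$, $\mu_{\vartriangleright,\vartriangleleft}((a,x),(b,y))=(a\cdot_A b,\ a\vartriangleright y+x\vartriangleleft b)$ and $\nu_{\rightharpoonup,\leftharpoonup}((a,x),(b,y))=(a\leftharpoonup y+x\rightharpoonup b,\ x\cdot_B y)$. A weak deformation map is a linear map $r:B\to A$ with $r(x)\cdot_A r(y)+r(x)\leftharpoonup y+x\rightharpoonup r(y)=r\big(x\cdot_B y+r(x)\vartriangleright y+x\vartriangleleft r(y)+\theta(r(x),r(y))\big)$ for all $x,y\in B$. Brackets are taken in the graded Lie algebra $\mathfrak g=\bigoplus_{n\ge0}\mathfrak g_n$, $\mathfrak g_n=\mathrm{Hom}((A\oplus B)^{\otimes n+1},A\oplus B)$, with the Gerstenhaber bracket: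 for $f$ with $m$ inputs and $g$ with $n$ inputs, $[f,g]=f\diamond g-(-1)^{(m-1)(n-1)}g\diamond f$, where $(f\diamond g)(v_1,\ldots,v_{m+n-1})=\sum_{i=1}^m(-1)^{(i-1)(n-1)}f(v_1,\ldots,v_{i-1},g(v_i,\ldots,v_{i+n-1}),v_{i+n},\ldots,v_{m+n-1})$. Maps $B^{\otimes n+1}\to A$ are regarded as elements of $\mathfrak g_n$ by extending them by zero, so $\mathfrak b\subset\mathfrak g$. An $L_\infty$-algebra is a graded vector space $\mathcal G$ with graded symmetric (with Koszul sign $\epsilon(\sigma)$) degree $1$ maps $l_k:\mathcal G^{\otimes k}\to\mathcal G$, $k\ge1$, such that for all $N\ge1$ and homogeneous $x_1,\ldots,x_N$: $\sum_{i=1}^N\sum_{\sigma\in Sh(i,N-i)}\epsilon(\sigma)\,l_{N-i+1}(l_i(x_{\sigma(1)},\ldots,x_{\sigma(i)}),x_{\sigma(i+1)},\ldots,x_{\sigma(N)})=0$, where $Sh(i,N-i)$ is the set of $(i,N-i)$-shuffles. A Maurer-Cartan element is $\alpha\in\mathcal G_0$ with $\sum_{k\ge1}\frac1{k!}l_k(\alpha,\ldots,\alpha)=0$. *)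

(* Defs.v *)
From HB Require Import structures.
From mathcomp Require Import all_boot all_order all_fingroup all_algebra.
From mathcomp Require Import sesquilinear boolp.

Set Implicit Arguments.
Unset Strict Implicit.
Unset Printing Implicit Defensive.

Import GRing.Theory.
Local Open Scope ring_scope.

(* Hom(U^{(x) n}, V) is rendered as the space of n-linear maps U^n -> V. *)
Section Multilinear.
Variables (K : fieldType) (U V : lmodType K).

Definition update n (v : 'I_n -> U) (i : 'I_n) (x : U) : 'I_n -> U :=
  fun j => if j == i then x else v j.

Definition multilinear n (f : ('I_n -> U) -> V) : Prop :=
  forall (v : 'I_n -> U) (i : 'I_n) (a : K) (x y : U),
    f (update v i (a *: x + y)) =
    a *: f (update v i x) + f (update v i y).

Record multilin n := Multilin {
  mfun :> ('I_n -> U) -> V;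
  mfunP : multilinear mfun }.

Lemma multilin_ext n (f g : multilin n) : (forall v, f v = g v) -> f = g.
Proof.
case: f g => f fP [g gP] /= fg.
have e : f = g by apply/funext.
by subst g; congr Multilin; apply: Prop_irrelevance.
Qed.

HB.instance Definition _ n := gen_eqMixin (multilin n).
HB.instance Definition _ n := gen_choiceMixin (multilin n).

Section Ops.
Variable n : nat.
Implicit Types f g h : multilin n.

Fact multilin_zero_subproof : multilinear (fun _ : 'I_n -> U => 0 : V).
Proof. by move=> *; rewrite scaler0 addr0. Qed.
Definition multilin_zero := Multilin multilin_zero_subproof.

Fact multilin_opp_subproof f : multilinear (fun v => - f v).
Proof. by move=> v i a x y; rewrite mfunP opprD scalerN. Qed.
Definition multilin_opp f := Multilin (multilin_opp_subproof f).

Fact multilin_add_subproof f g : multilinear (fun v => f v + g v).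
Proof. by move=> v i a x y; rewrite !mfunP scalerDr addrACA. Qed.
Definition multilin_add f g := Multilin (multilin_add_subproof f g).

Fact multilin_scale_subproof (c : K) f : multilinear (fun v => c *: f v).
Proof. by move=> v i a x y; rewrite mfunP scalerDr !scalerA mulrC. Qed.
Definition multilin_scale c f := Multilin (multilin_scale_subproof c f).

Fact multilin_addA : associative multilin_add.
Proof. by move=> f g h; apply: multilin_ext => v /=; rewrite addrA. Qed.
Fact multilin_addC : commutative multilin_add.
Proof. by move=> f g; apply: multilin_ext => v /=; rewrite addrC. Qed.
Fact multilin_add0 : left_id multilin_zero multilin_add.
Proof. by move=> f; apply: multilin_ext => v /=; rewrite add0r. Qed.
Fact multilin_addN : left_inverse multilin_zero multilin_opp multilin_add.
Proof. by move=> f; apply: multilin_ext => v /=; rewrite addNr. Qed.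

HB.instance Definition _ := GRing.isZmodule.Build (multilin n)
  multilin_addA multilin_addC multilin_add0 multilin_addN.

Fact multilin_scaleA a b f :
  multilin_scale a (multilin_scale b f) = multilin_scale (a * b) f.
Proof. by apply: multilin_ext => v /=; rewrite scalerA. Qed.
Fact multilin_scale1 : left_id 1 multilin_scale.
Proof. by move=> f; apply: multilin_ext => v /=; rewrite scale1r. Qed.
Fact multilin_scaleDr : right_distributive multilin_scale +%R.
Proof. by move=> a f g; apply: multilin_ext => v /=; rewrite scalerDr. Qed.
Fact multilin_scaleDl f :
  {morph multilin_scale^~ f : a b / a + b >-> a + b}.
Proof. by move=> a b; apply: multilin_ext => v /=; rewrite scalerDl. Qed.

HB.instance Definition _ := GRing.Zmodule_isLmodule.Build K (multilin n)
  multilin_scaleA multilin_scale1 multilin_scaleDr multilin_scaleDl.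

End Ops.
End Multilinear.

Arguments multilin {K} U V n.

Section LinearAsMultilinear.
Variables (K : fieldType) (U V : lmodType K).

Fact multilin_of_linear_subproof (r : {linear U -> V}) :
  multilinear (fun v : 'I_1 -> U => r (v ord0)).
Proof. by move=> v i a x y; rewrite ord1 /update eqxx linearP. Qed.
Definition multilin_of_linear (r : {linear U -> V}) : multilin U V 1 :=
  Multilin (multilin_of_linear_subproof r).

Fact multilin_of_binary_subproof (m : U -> U -> V) :
    (forall z, linear (m ^~ z)) -> (forall z, linear (m z)) ->
  multilinear (fun v : 'I_2 -> U => m (v ord0) (v ord_max)).
Proof.
move=> ml mr v i a x y; rewrite /update.
by case: i => [[|[|i]] // lti]; rewrite /eq_op /= ?ml ?mr.
Qed.
Definition multilin_of_binary (m : U -> U -> V)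
    (ml : forall z, linear (m ^~ z)) (mr : forall z, linear (m z)) :
    multilin U V 2 :=
  Multilin (multilin_of_binary_subproof ml mr).

End LinearAsMultilinear.

Section Gerstenhaber.
Variables (K : fieldType) (V : lmodType K).

(* f <> g for f of degree p (p + 1 inputs) and g of degree q (q + 1 inputs),
   written with 0-based indices.  The result has N + 1 inputs with N = p + q;
   N is kept as a separate parameter so that f <> g and g <> f can be
   subtracted without a cast. *)
Definition diamond p q N (f : multilin V V p.+1) (g : multilin V V q.+1)
    (v : 'I_N.+1 -> V) : V :=
  \sum_(i < p.+1) (-1) ^+ (i * q) *:
    f (fun j : 'I_p.+1 =>
         if (j < i)%N then v (inord j)
         else if j == i then g (fun t : 'I_q.+1 => v (inord (i + t)))
         else v (inord (j + q))).

Lemma diamond_multilinear p q N (f : multilin V V p.+1)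
    (g : multilin V V q.+1) :
  N = (p + q)%N -> multilinear (@diamond p q N f g).
Proof.
move=> eN v k a x y; rewrite /diamond scaler_sumr -big_split /=.
apply: eq_bigr => i _.
rewrite scalerA mulrC -scalerA -scalerDr; congr (_ *: _).
have lti := ltn_ord i; have ltk := ltn_ord k.
pose w := fun j : 'I_p.+1 =>
  if (j < i)%N then v (inord j)
  else if j == i then g (fun t : 'I_q.+1 => v (inord (i + t)))
  else v (inord (j + q)).
have eqI m : (m < N.+1)%N -> (inord m == k) = (m == k :> nat).
  by move=> ltm; rewrite -val_eqE /= inordK.
have eqO M (j : 'I_M) m (ltm : (m < M)%N) :
  (j == Ordinal ltm) = (j == m :> nat) by [].
have ltj (j : 'I_p.+1) : (j + q < N.+1)%N.
  by rewrite eN ltnS leq_add2r -ltnS.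
have ltj' (j : 'I_p.+1) : (j < N.+1)%N.
  by apply: leq_ltn_trans (ltj j); apply: leq_addr.
have ltt (t : 'I_q.+1) : (i + t < N.+1)%N.
  by rewrite eN ltnS leq_add // -ltnS.
have [ki|ik] := ltnP k i.
  have E z : (fun j : 'I_p.+1 => if (j < i)%N then update v k z (inord j)
       else if j == i then g (fun t : 'I_q.+1 => update v k z (inord (i + t)))
       else update v k z (inord (j + q))) =
       update w (Ordinal (ltn_trans ki lti)) z.
    apply/funext => j; rewrite /update /w eqO.
    case: ifP => [ji|/negbT]; first by rewrite eqI.
    rewrite -leqNgt => ij; rewrite (gtn_eqF (leq_trans ki ij)).
    case: ifP => [_|_].
      congr (mfun _ _); apply/funext => t.
      by rewrite eqI ?ltt // (gtn_eqF (leq_trans ki (leq_addr _ _))).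
    by rewrite eqI // (gtn_eqF (leq_trans ki (leq_trans ij (leq_addr _ _)))).
  by rewrite !E mfunP.
have [kiq|iqk] := leqP k (i + q).
  have ltki : (k - i < q.+1)%N by rewrite ltnS leq_subLR.
  have E z : (fun j : 'I_p.+1 => if (j < i)%N then update v k z (inord j)
       else if j == i then g (fun t : 'I_q.+1 => update v k z (inord (i + t)))
       else update v k z (inord (j + q))) =
       update w i (g (update (fun t : 'I_q.+1 => v (inord (i + t)))
                        (Ordinal ltki) z)).
    apply/funext => j; rewrite /update /w.
    case: (ltngtP j i) => [ji|ij|/val_inj ->]; last first.
    - rewrite eqxx; congr (mfun _ _); apply/funext => t.
      rewrite eqI ?ltt // eqO; congr (if _ then _ else _).
      by apply/eqP/eqP => [<-|->]; rewrite ?addKn // subnKC.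
    - rewrite -(inj_eq val_inj j i) /= (gtn_eqF ij) eqI //.
      by rewrite (gtn_eqF (leq_ltn_trans kiq _)) // ltn_add2r.
    rewrite -(inj_eq val_inj j i) /= (ltn_eqF ji) eqI //.
    by rewrite (ltn_eqF (leq_trans ji ik)).
  by rewrite !E mfunP mfunP.
have qk : (q <= k)%N by apply: leq_trans (ltnW iqk); apply: leq_addl.
have ltkq : (k - q < p.+1)%N by rewrite ltnS leq_subLR addnC -eN -ltnS.
have E z : (fun j : 'I_p.+1 => if (j < i)%N then update v k z (inord j)
     else if j == i then g (fun t : 'I_q.+1 => update v k z (inord (i + t)))
     else update v k z (inord (j + q))) =
     update w (Ordinal ltkq) z.
  apply/funext => j; rewrite /update /w eqO -(inj_eq val_inj j i) /=.
  have ikq : (i < k - q)%N by rewrite ltn_subRL addnC.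
  case: (ltngtP j i) => [ji|ij|ji].
  - rewrite (ltn_eqF (ltn_trans ji ikq)) eqI //.
    by rewrite (ltn_eqF (leq_trans ji ik)).
  - rewrite eqI //; congr (if _ then _ else _).
    by apply/eqP/eqP => [<-|->]; rewrite ?addnK // subnK.
  - rewrite ji (ltn_eqF ikq); congr (mfun _ _); apply/funext => t.
    rewrite eqI ?ltt // (ltn_eqF (leq_ltn_trans _ iqk)) //.
    by rewrite leq_add2l -ltnS.
by rewrite !E mfunP.
Qed.

Fact bracket_subproof p q (f : multilin V V p.+1) (g : multilin V V q.+1) :
  multilinear (fun v : 'I_(p + q).+1 -> V =>
    diamond f g v - (-1) ^+ (p * q) *: diamond g f v).
Proof.
move=> v i a x y.
rewrite (diamond_multilinear f g) // (diamond_multilinear g f) ?(addnC p) //.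
by rewrite !scalerDr opprD scalerN !scalerA (mulrC a) addrACA.
Qed.
Definition bracket p q (f : multilin V V p.+1) (g : multilin V V q.+1) :
    multilin V V (p + q).+1 :=
  Multilin (bracket_subproof f g).

End Gerstenhaber.

(* Extension by zero of a map B^{(x) n} -> A to (A (+) B)^{(x) n}. *)
Section Extension.
Variables (K : fieldType) (A B : lmodType K) (n : nat).

Fact extend_subproof (f : multilin B A n) :
  multilinear (fun v : 'I_n -> (A * B)%type =>
    (f (fun i => (v i).2), 0) : (A * B)%type).
Proof.
move=> v i a x y.
have E z : (fun j => (update v i z j).2) = update (fun j => (v j).2) i z.2.
  by apply/funext => j; rewrite /update; case: ifP.
rewrite !E /= mfunP; congr pair => /=.
by rewrite scaler0 addr0.
Qed.
Definition extend (f : multilin B A n) :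
    multilin (A * B)%type (A * B)%type n :=
  Multilin (extend_subproof f).

End Extension.

Section QuasiTwilled.
Variables (K : fieldType) (A B : lmodType K).

(* Algebras are not assumed unital. *)
Record quasi_twilled := QuasiTwilled {
  qt_mul : {bilinear (A * B)%type -> (A * B)%type -> (A * B)%type};
  qt_assoc : forall u v w, qt_mul u (qt_mul v w) = qt_mul (qt_mul u v) w;
  qt_sub : forall x y : B, (qt_mul (0, x) (0, y)).1 = 0 }.

Variable Q : quasi_twilled.

Definition mulA (a b : A) : A := (qt_mul Q (a, 0) (b, 0)).1.
Definition theta (a b : A) : B := (qt_mul Q (a, 0) (b, 0)).2.
Definition mulB (x y : B) : B := (qt_mul Q (0, x) (0, y)).2.
(* a |> y,  x <| b,  x -^ b  and  a ^- y  (the last two with values in A) *)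
Definition rtri (a : A) (y : B) : B := (qt_mul Q (a, 0) (0, y)).2.
Definition ltri (x : B) (b : A) : B := (qt_mul Q (0, x) (b, 0)).2.
Definition rharp (x : B) (b : A) : A := (qt_mul Q (0, x) (b, 0)).1.
Definition lharp (a : A) (y : B) : A := (qt_mul Q (a, 0) (0, y)).1.

Lemma qt_mulE a x b y :
  qt_mul Q (a, x) (b, y) =
  (mulA a b + lharp a y + rharp x b,
   mulB x y + rtri a y + ltri x b + theta a b).
Proof.
have E (c : A) (z : B) : (c, z) = (c, 0) + (0, z) :> (A * B)%type.
  by congr pair; rewrite /= ?addr0 ?add0r.
rewrite (E a x) (E b y) linearDl !linearDr /=.
rewrite [LHS]surjective_pairing /= qt_sub addr0 addrA.
congr pair; rewrite -/(theta a b) -/(mulB x y) -/(rtri a y) -/(ltri x b).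
by rewrite [LHS]addrC -(addrA (theta _ _)) (addrC (theta _ _)) !addrA.
Qed.

Let V : lmodType K := (A * B)%type.

Lemma pairDZ1 (k : K) (u v : V) :
  ((k *: u + v).1, 0) = k *: (u.1, 0) + (v.1, 0) :> V.
Proof. by congr pair; rewrite /= scaler0 addr0. Qed.

Lemma pairDZ2 (k : K) (u v : V) :
  (0, (k *: u + v).2) = k *: (0, u.2) + (0, v.2) :> V.
Proof. by congr pair; rewrite /= scaler0 addr0. Qed.

Definition theta_fun (u v : V) : V := (0, theta u.1 v.1).
Definition mu_fun (u v : V) : V :=
  (mulA u.1 v.1, rtri u.1 v.2 + ltri u.2 v.1).
Definition nu_fun (u v : V) : V :=
  (lharp u.1 v.2 + rharp u.2 v.1, mulB u.2 v.2).

Fact theta_linl z : linear (theta_fun ^~ z).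
Proof.
move=> k u v; rewrite /theta_fun /theta pairDZ1 linearPl.
exact: pairDZ2.
Qed.
Fact theta_linr z : linear (theta_fun z).
Proof.
move=> k u v; rewrite /theta_fun /theta pairDZ1 linearPr.
exact: pairDZ2.
Qed.

Fact mu_linl z : linear (mu_fun ^~ z).
Proof.
move=> k u v; rewrite /mu_fun /mulA /rtri /ltri pairDZ1 pairDZ2 !linearPl.
by congr pair; rewrite /= scalerDr addrACA.
Qed.
Fact mu_linr z : linear (mu_fun z).
Proof.
move=> k u v; rewrite /mu_fun /mulA /rtri /ltri pairDZ1 pairDZ2 !linearPr.
by congr pair; rewrite /= scalerDr addrACA.
Qed.

Fact nu_linl z : linear (nu_fun ^~ z).
Proof.
move=> k u v; rewrite /nu_fun /mulB /rharp /lharp pairDZ1 pairDZ2 !linearPl.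
by congr pair; rewrite /= scalerDr addrACA.
Qed.
Fact nu_linr z : linear (nu_fun z).
Proof.
move=> k u v; rewrite /nu_fun /mulB /rharp /lharp pairDZ1 pairDZ2 !linearPr.
by congr pair; rewrite /= scalerDr addrACA.
Qed.

Definition theta_tilde : multilin V V 2 :=
  multilin_of_binary theta_linl theta_linr.
Definition mu_tri : multilin V V 2 := multilin_of_binary mu_linl mu_linr.
Definition nu_harp : multilin V V 2 := multilin_of_binary nu_linl nu_linr.

Definition weak_deformation_map (r : {linear B -> A}) : Prop :=
  forall x y : B,
    mulA (r x) (r y) + lharp (r x) y + rharp x (r y) =
    r (mulB x y + rtri (r x) y + ltri x (r y) + theta (r x) (r y)).

End QuasiTwilled.

(* External direct sum of a family of vector spaces indexed by nat. *)
Section DirectSum.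
Variables (K : fieldType) (G : nat -> lmodType K).

Record dsum := DSum {
  coord :> forall n, G n;
  coord_fin : exists N, forall n, (N <= n)%N -> coord n = 0 }.

Lemma dsum_ext (x y : dsum) : (forall n, x n = y n) -> x = y.
Proof.
case: x y => x xP [y yP] /= xy.
have e : x = y by apply: functional_extensionality_dep.
by subst y; congr DSum; apply: Prop_irrelevance.
Qed.

HB.instance Definition _ := gen_eqMixin dsum.
HB.instance Definition _ := gen_choiceMixin dsum.

Fact dsum_zero_subproof :
  exists N, forall n, (N <= n)%N -> (0 : G n) = 0.
Proof. by exists 0%N. Qed.
Definition dsum_zero := DSum dsum_zero_subproof.

Fact dsum_opp_subproof (x : dsum) :
  exists N, forall n, (N <= n)%N -> - x n = 0.
Proof.
by have [N xN] := coord_fin x; exists N => n /xN ->; rewrite oppr0.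
Qed.
Definition dsum_opp x := DSum (dsum_opp_subproof x).

Fact dsum_add_subproof (x y : dsum) :
  exists N, forall n, (N <= n)%N -> x n + y n = 0.
Proof.
have [[N xN] [M yM]] := (coord_fin x, coord_fin y).
by exists (maxn N M) => n; rewrite geq_max => /andP[/xN-> /yM->]; rewrite addr0.
Qed.
Definition dsum_add x y := DSum (dsum_add_subproof x y).

Fact dsum_scale_subproof (a : K) (x : dsum) :
  exists N, forall n, (N <= n)%N -> a *: x n = 0.
Proof.
by have [N xN] := coord_fin x; exists N => n /xN ->; rewrite scaler0.
Qed.
Definition dsum_scale a x := DSum (dsum_scale_subproof a x).

Fact dsum_addA : associative dsum_add.
Proof. by move=> x y z; apply: dsum_ext => n /=; rewrite addrA. Qed.
Fact dsum_addC : commutative dsum_add.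
Proof. by move=> x y; apply: dsum_ext => n /=; rewrite addrC. Qed.
Fact dsum_add0 : left_id dsum_zero dsum_add.
Proof. by move=> x; apply: dsum_ext => n /=; rewrite add0r. Qed.
Fact dsum_addN : left_inverse dsum_zero dsum_opp dsum_add.
Proof. by move=> x; apply: dsum_ext => n /=; rewrite addNr. Qed.

HB.instance Definition _ := GRing.isZmodule.Build dsum
  dsum_addA dsum_addC dsum_add0 dsum_addN.

Fact dsum_scaleA a b x : dsum_scale a (dsum_scale b x) = dsum_scale (a * b) x.
Proof. by apply: dsum_ext => n /=; rewrite scalerA. Qed.
Fact dsum_scale1 : left_id 1 dsum_scale.
Proof. by move=> x; apply: dsum_ext => n /=; rewrite scale1r. Qed.
Fact dsum_scaleDr : right_distributive dsum_scale +%R.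
Proof. by move=> a x y; apply: dsum_ext => n /=; rewrite scalerDr. Qed.
Fact dsum_scaleDl x : {morph dsum_scale^~ x : a b / a + b >-> a + b}.
Proof. by move=> a b; apply: dsum_ext => n /=; rewrite scalerDl. Qed.

HB.instance Definition _ := GRing.Zmodule_isLmodule.Build K dsum
  dsum_scaleA dsum_scale1 dsum_scaleDr dsum_scaleDl.

Fact dsum_in_subproof n (x : G n) :
  exists N, forall m, (N <= m)%N -> dfwith (fun k => 0 : G k) x m = 0.
Proof.
exists n.+1 => m ltnm; apply: dfwith_out.
by rewrite (ltn_eqF ltnm).
Qed.
Definition dsum_in n (x : G n) : dsum := DSum (dsum_in_subproof x).

(* The Z-grading of the direct sum; it is zero in negative degrees. *)
Definition dsum_grade (n : int) (x : dsum) : Prop :=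
  forall m : nat, m%:Z != n -> x m = 0.

End DirectSum.

Arguments dsum {K} G.
Arguments dsum_in {K} G n x.
Arguments dsum_grade {K} G n x.

Section Linfty.
Variables (K : fieldType) (G : lmodType K).

(* G is the internal direct sum of the subspaces gr n, n in Z. *)
Record is_grading (gr : int -> G -> Prop) : Prop := IsGrading {
  grading0 : forall n, gr n 0;
  gradingP : forall n a x y, gr n x -> gr n y -> gr n (a *: x + y);
  grading_span : forall x, exists (s : seq int) (y : int -> G),
    [/\ uniq s, forall n, gr n (y n) & x = \sum_(n <- s) y n];
  grading_free : forall (s : seq int) (y : int -> G),
    uniq s -> (forall n, gr n (y n)) -> \sum_(n <- s) y n = 0 ->
    forall n, n \in s -> y n = 0 }.

(* Koszul sign of x_0 ... x_(N-1) |-> x_(s 0) ... x_(s (N-1)), where x_i has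
   degree d i; (-1) ^ m is the integer power. *)
Definition koszul N (s : 'S_N) (d : 'I_N -> int) : K :=
  \prod_(i < N) \prod_(j < N | (i < j)%N && (s j < s i)%N)
    (-1) ^ (d (s i) * d (s j)).

Definition shuffles N i : {set 'S_N} :=
  [set s : 'S_N | [forall a : 'I_N, forall b : 'I_N,
     ((a < b) && ((b < i) || (i <= a)))%N ==> (s a < s b)%N]].

(* Only the operations l k with k >= 1 are part of the structure: l 0 is
   ignored.  In the higher Jacobi identity N is replaced by N + 1, so that it
   ranges over all N >= 1, and indices are 0-based. *)
Record is_Linfty (gr : int -> G -> Prop) (l : forall k, multilin G G k) :
    Prop := IsLinfty {
  Linfty_grading : is_grading gr;
  Linfty_degree : forall k (d : 'I_k -> int) (x : 'I_k -> G),
    (0 < k)%N -> (forall i, gr (d i) (x i)) ->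
    gr (\sum_i d i + 1) (l k x);
  Linfty_symmetric :
    forall k (d : 'I_k -> int) (x : 'I_k -> G) (s : 'S_k),
    (0 < k)%N -> (forall i, gr (d i) (x i)) ->
    l k (fun i => x (s i)) = koszul s d *: l k x;
  Linfty_jacobi : forall N (d : 'I_N.+1 -> int) (x : 'I_N.+1 -> G),
    (forall i, gr (d i) (x i)) ->
    \sum_(1 <= i < N.+2) \sum_(s in shuffles N.+1 i)
      koszul s d *:
        l (N.+1 - i).+1 (fun j =>
          if j == ord0 then l i (fun t => x (s (inord t)))
          else x (s (inord (i + j).-1))) = 0 }.

(* The Maurer-Cartan sum is required to be finite. *)
Definition maurer_cartan (gr : int -> G -> Prop) (l : forall k, multilin G G k)
    (alpha : G) : Prop :=
  gr 0 alpha /\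
  exists n, (forall k, (n < k)%N -> l k (fun=> alpha) = 0) /\
    \sum_(1 <= k < n.+1) (k`!%:R : K)^-1 *: l k (fun=> alpha) = 0.

End Linfty.

Section SpaceB.
Variables (K : fieldType) (A B : lmodType K).

Definition bcomp (n : nat) : lmodType K := multilin B A n.+1.
Definition bspace : lmodType K := dsum bcomp.

End SpaceB.

(* Main.v *)
Require Import Defs.
From HB Require Import structures.
From mathcomp Require Import all_boot all_order all_fingroup all_algebra.
From mathcomp Require Import sesquilinear boolp.

Set Implicit Arguments.
Unset Strict Implicit.
Unset Printing Implicit Defensive.

Import GRing.Theory.
Local Open Scope ring_scope.

(** Put V = A (+) B.  Everything takes place inside one associative algebra.
    Let M be the space of families of multilinear maps V^n -> V, n >= 0, written
    as functions on lists of vectors.  A cochain f : V^(p+1) -> V acts on M by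
    inserting f, with the usual signs, at all places of a list ([iop]), and M
    is viewed as a right module over the operators so obtained.  Two successive
    insertions are either nested or disjoint ([insert_insert]).  The nested ones
    give the insertion of the Gerstenhaber composition, and the disjoint ones
    are graded symmetric; hence the graded commutator of two insertion operators
    is the insertion operator of the Gerstenhaber bracket ([iop_bracket]).
    Since f can be read off from its operator, all identities between brackets
    become identities between graded commutators in an associative algebra, and
    no Jacobi identity for the Gerstenhaber bracket is needed.

    The number of inputs from A minus the number of outputs in A is a weight
    that is additive under the bracket.  It is the eigenvalue of the commutator
    with the projection onto A ([weight]).  Write Delta_1, Delta_2, Delta_3 for
    the operators of nu, mu and theta; Delta_k has weight k - 1, while the maps
    from B to A, extended by zero, are exactly the maps of weight -1
    ([extend_restrict]).  They commute in the graded sense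
    ([extend_gcommutes]).  So the k-fold commutator l_k(x_1, .., x_k) of Delta_k
    with such maps x_i is again such a map ([from_b_closed]), and any further
    commutator with one of them is zero.

    Associativity of the multiplication of V says that
    (Delta_1 + Delta_2 + Delta_3)^2 = 0.  Its weight components vanish
    separately in characteristic 0, which gives
    sum_(i + j = n) Delta_i Delta_j = 0 for all n ([Delta_sqr0]).  Taking the
    iterated commutator of this equation for n = N + 1 with x_1, .., x_N, the
    graded Leibniz rule ([ibrM]) expands it into products
    Delta_i(x_S) Delta_j(x_T) over all splittings of the arguments, where
    Delta_i(x_S) denotes the iterated commutator.  By the vanishing just
    mentioned only |S| = i or |T| = j survive, and these two kinds of terms pair
    up to the commutators [Delta_j(x_T), l_i(x_S)], that is, up to sign,
    l_j(l_i(x_S), x_T).  This is the higher Jacobi identity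
    ([higher_jacobi], [lop_jacobi]).  Splittings are encoded by boolean masks
    and are matched with shuffles, together with their Koszul signs, in
    [big_shuffles] and [sort_sign_mask].  Graded symmetry holds because the x_i
    commute ([ibr_sort]).

    For r : B -> A the brackets in the Maurer-Cartan sum are computed on two
    vectors of B: l_1, l_2 / 2 and l_3 / 6 give the terms of the weak
    deformation map equation in which the structure maps nu, mu and theta occur
    ([maurer_cartan_coord]). *)

(** * The algebra of endomorphisms *)

Section Endomorphisms.
Variables (K : fieldType) (U : lmodType K).

(** Linear endomorphisms of [U], multiplied in the order of application:
    [S * T] is [S] followed by [T]. *)
Record endo := Endo { endo_fun :> U -> U; endoP : linear endo_fun }.

Lemma endo_ext (S T : endo) : (forall u, S u = T u) -> S = T.
Proof.
case: S T => S SP [T TP] /= ST.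
have e : S = T by apply/funext.
by subst T; congr Endo; apply: Prop_irrelevance.
Qed.

HB.instance Definition _ := gen_eqMixin endo.
HB.instance Definition _ := gen_choiceMixin endo.

Fact endo_zero_subproof : linear (fun _ : U => 0 : U).
Proof. by move=> a u w; rewrite scaler0 addr0. Qed.
Definition endo_zero := Endo endo_zero_subproof.

Fact endo_opp_subproof (S : endo) : linear (fun u => - S u).
Proof. by move=> a u w; rewrite endoP opprD scalerN. Qed.
Definition endo_opp S := Endo (endo_opp_subproof S).

Fact endo_add_subproof (S T : endo) : linear (fun u => S u + T u).
Proof. by move=> a u w; rewrite !endoP scalerDr addrACA. Qed.
Definition endo_add S T := Endo (endo_add_subproof S T).

Fact endo_scale_subproof (c : K) (S : endo) : linear (fun u => c *: S u).
Proof. by move=> a u w; rewrite endoP scalerDr !scalerA mulrC. Qed.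
Definition endo_scale c S := Endo (endo_scale_subproof c S).

Fact endo_one_subproof : linear (fun u : U => u).
Proof. by []. Qed.
Definition endo_one := Endo endo_one_subproof.

Fact endo_mul_subproof (S T : endo) : linear (fun u => T (S u)).
Proof. by move=> a u w; rewrite !endoP. Qed.
Definition endo_mul S T := Endo (endo_mul_subproof S T).

Fact endo_addA : associative endo_add.
Proof. by move=> S T X; apply: endo_ext => u /=; rewrite addrA. Qed.
Fact endo_addC : commutative endo_add.
Proof. by move=> S T; apply: endo_ext => u /=; rewrite addrC. Qed.
Fact endo_add0 : left_id endo_zero endo_add.
Proof. by move=> S; apply: endo_ext => u /=; rewrite add0r. Qed.
Fact endo_addN : left_inverse endo_zero endo_opp endo_add.
Proof. by move=> S; apply: endo_ext => u /=; rewrite addNr. Qed.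

HB.instance Definition _ := GRing.isZmodule.Build endo
  endo_addA endo_addC endo_add0 endo_addN.

Fact endo_scaleA a b S :
  endo_scale a (endo_scale b S) = endo_scale (a * b) S.
Proof. by apply: endo_ext => u /=; rewrite scalerA. Qed.
Fact endo_scale1 : left_id 1 endo_scale.
Proof. by move=> S; apply: endo_ext => u /=; rewrite scale1r. Qed.
Fact endo_scaleDr : right_distributive endo_scale +%R.
Proof. by move=> a S T; apply: endo_ext => u /=; rewrite scalerDr. Qed.
Fact endo_scaleDl S : {morph endo_scale^~ S : a b / a + b >-> a + b}.
Proof. by move=> a b; apply: endo_ext => u /=; rewrite scalerDl. Qed.

HB.instance Definition _ := GRing.Zmodule_isLmodule.Build K endo
  endo_scaleA endo_scale1 endo_scaleDr endo_scaleDl.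

Fact endo_mulA : associative endo_mul.
Proof. by move=> S T X; apply: endo_ext. Qed.
Fact endo_mul1 : left_id endo_one endo_mul.
Proof. by move=> S; apply: endo_ext. Qed.
Fact endo_1mul : right_id endo_one endo_mul.
Proof. by move=> S; apply: endo_ext. Qed.
Fact endo_mulDl : left_distributive endo_mul +%R.
Proof.
move=> S T X; apply: endo_ext => u /=.
by rewrite -[S u]scale1r endoP !scale1r.
Qed.
Fact endo_mulDr : right_distributive endo_mul +%R.
Proof. by move=> S T X; apply: endo_ext. Qed.

HB.instance Definition _ := GRing.Zmodule_isPzRing.Build endo
  endo_mulA endo_mul1 endo_1mul endo_mulDl endo_mulDr.

Implicit Types (S T : endo) (u w : U).

Lemma endoM S T u : (S * T) u = T (S u). Proof. by []. Qed.
Lemma endoD S T u : (S + T) u = S u + T u. Proof. by []. Qed.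
Lemma endoN S u : (- S) u = - S u. Proof. by []. Qed.
Lemma endoZ c S u : (c *: S) u = c *: S u. Proof. by []. Qed.

Lemma endo_scalerAl c S T : c *: (S * T) = (c *: S) * T.
Proof.
apply: endo_ext => u; rewrite endoZ !endoM endoZ.
have T0 : T 0 = 0 by have := endoP T (-1) 0 0; rewrite !scaleN1r !addNr.
by rewrite -[c *: S u]addr0 endoP T0 addr0.
Qed.

Lemma endo_scalerAr c S T : c *: (S * T) = S * (c *: T).
Proof. exact: endo_ext. Qed.

End Endomorphisms.

(** * Multilinear functions on lists and insertion operators *)

Section Insertion.
Variables (K : fieldType) (V : lmodType K).
Implicit Types (s t a c : seq V) (u v w : V).

(** A family of multilinear maps of all arities at once: a function on lists
    that is linear in each entry of the list. *)
Record mseq := Mseq {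
  mseq_fun :> seq V -> V;
  mseqP : forall a c k u w, mseq_fun (a ++ (k *: u + w) :: c) =
            k *: mseq_fun (a ++ u :: c) + mseq_fun (a ++ w :: c) }.

Lemma mseq_ext (F G : mseq) : (forall s, F s = G s) -> F = G.
Proof.
case: F G => F FP [G GP] /= FG.
have e : F = G by apply/funext.
by subst G; congr Mseq; apply: Prop_irrelevance.
Qed.

HB.instance Definition _ := gen_eqMixin mseq.
HB.instance Definition _ := gen_choiceMixin mseq.

Implicit Types F G : mseq.

Fact mseq_zero_subproof a c (k : K) u w :
  0 = k *: 0 + 0 :> V.
Proof. by rewrite scaler0 addr0. Qed.
Definition mseq_zero := @Mseq (fun=> 0) mseq_zero_subproof.

Fact mseq_opp_subproof (F : mseq) a c k u w :
  - F (a ++ (k *: u + w) :: c) = k *: - F (a ++ u :: c) + - F (a ++ w :: c).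
Proof. by rewrite mseqP opprD scalerN. Qed.
Definition mseq_opp F := @Mseq (fun s => - F s) (mseq_opp_subproof F).

Fact mseq_add_subproof (F G : mseq) a c k u w :
  F (a ++ (k *: u + w) :: c) + G (a ++ (k *: u + w) :: c) =
  k *: (F (a ++ u :: c) + G (a ++ u :: c)) +
  (F (a ++ w :: c) + G (a ++ w :: c)).
Proof. by rewrite !mseqP scalerDr addrACA. Qed.
Definition mseq_add F G :=
  @Mseq (fun s => F s + G s) (mseq_add_subproof F G).

Fact mseq_scale_subproof (b : K) (F : mseq) a c k u w :
  b *: F (a ++ (k *: u + w) :: c) =
  k *: (b *: F (a ++ u :: c)) + b *: F (a ++ w :: c).
Proof. by rewrite mseqP scalerDr !scalerA mulrC. Qed.
Definition mseq_scale b F :=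
  @Mseq (fun s => b *: F s) (mseq_scale_subproof b F).

Fact mseq_addA : associative mseq_add.
Proof. by move=> F G H; apply: mseq_ext => s /=; rewrite addrA. Qed.
Fact mseq_addC : commutative mseq_add.
Proof. by move=> F G; apply: mseq_ext => s /=; rewrite addrC. Qed.
Fact mseq_add0 : left_id mseq_zero mseq_add.
Proof. by move=> F; apply: mseq_ext => s /=; rewrite add0r. Qed.
Fact mseq_addN : left_inverse mseq_zero mseq_opp mseq_add.
Proof. by move=> F; apply: mseq_ext => s /=; rewrite addNr. Qed.

HB.instance Definition _ := GRing.isZmodule.Build mseq
  mseq_addA mseq_addC mseq_add0 mseq_addN.

Fact mseq_scaleA k l F : mseq_scale k (mseq_scale l F) = mseq_scale (k * l) F.
Proof. by apply: mseq_ext => s /=; rewrite scalerA. Qed.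
Fact mseq_scale1 : left_id 1 mseq_scale.
Proof. by move=> F; apply: mseq_ext => s /=; rewrite scale1r. Qed.
Fact mseq_scaleDr : right_distributive mseq_scale +%R.
Proof. by move=> k F G; apply: mseq_ext => s /=; rewrite scalerDr. Qed.
Fact mseq_scaleDl F : {morph mseq_scale^~ F : k l / k + l >-> k + l}.
Proof. by move=> k l; apply: mseq_ext => s /=; rewrite scalerDl. Qed.

HB.instance Definition _ := GRing.Zmodule_isLmodule.Build K mseq
  mseq_scaleA mseq_scale1 mseq_scaleDr mseq_scaleDl.

Lemma mseqD F G s : (F + G) s = F s + G s. Proof. by []. Qed.
Lemma mseqN F s : (- F) s = - F s. Proof. by []. Qed.
Lemma mseqZ (b : K) F s : (b *: F) s = b *: F s. Proof. by []. Qed.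

Lemma mseq_entryD F a c u w : F (a ++ (u + w) :: c) = F (a ++ u :: c) + F
  (a ++ w :: c).
Proof. by rewrite -[u]scale1r mseqP !scale1r. Qed.
Lemma mseq_entry0 F a c : F (a ++ 0 :: c) = 0.
Proof. by have := mseqP F a c (-1) 0 0; rewrite !scaleN1r !addNr. Qed.
Lemma mseq_entryZ F a c k u : F (a ++ k *: u :: c) = k *: F (a ++ u :: c).
Proof. by rewrite -[k *: u]addr0 mseqP mseq_entry0 addr0. Qed.

(** [F] with [v] put in front of the list. *)
Fact mseq_cons_subproof F v a c k u w :
  F (v :: (a ++ (k *: u + w) :: c)) =
  k *: F (v :: a ++ u :: c) + F (v :: a ++ w :: c).
Proof. exact: (mseqP F (v :: a)). Qed.
Definition mseq_cons F v := @Mseq (fun s => F (v :: s))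
  (mseq_cons_subproof F v).

Lemma mseq_consE F v s : mseq_cons F v s = F (v :: s). Proof. by []. Qed.

Lemma mseq_cons_lin F k u w :
  mseq_cons F (k *: u + w) = k *: mseq_cons F u + mseq_cons F w.
Proof. by apply: mseq_ext => s; exact: (mseqP F [::]). Qed.

(** The value of an [n]-linear map on the first [n] entries of a list. *)
Definition on_list n (f : multilin V V n) s : V :=
  f (fun i : 'I_n => nth 0 s i).

Lemma on_list_cat n (f : multilin V V n) a c :
  size a = n -> on_list f (a ++ c) = on_list f a.
Proof.
move=> an; rewrite /on_list; congr (Defs.mfun f _); apply/funext => i.
by rewrite nth_cat an ltn_ord.
Qed.

Lemma on_list_linear n (f : multilin V V n) a c k u w : (size a < n)%N ->
  on_list f (a ++ (k *: u + w) :: c) =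
  k *: on_list f (a ++ u :: c) + on_list f (a ++ w :: c).
Proof.
move=> an; rewrite /on_list.
pose b := fun i : 'I_n => nth 0 (a ++ 0 :: c) i.
have E z : (fun i : 'I_n => nth 0 (a ++ z :: c) i) = update b (Ordinal an) z.
  apply/funext => i; rewrite /update /b -val_eqE /= !nth_cat.
  case: (ltngtP i (size a)) => // [ia|->]; last by rewrite subnn.
  by rewrite -(subnSK ia).
by rewrite !E mfunP.
Qed.

(** Insertion of [f] into [F] at all possible places, with the signs of the
    Gerstenhaber composition. *)
Fixpoint insert p (f : multilin V V p.+1) (F : seq V -> V) s : V :=
  if s is v :: s' then
    (if (p <= size s')%N then F (on_list f s :: drop p s') else 0) +
    (-1) ^+ p *: insert f (fun t => F (v :: t)) s'
  else 0.

Section OneMap.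
Variables (p : nat) (f : multilin V V p.+1).

Lemma insert_consE F v s : insert f F (v :: s) =
  (if (p <= size s)%N then F (on_list f (v :: s) :: drop p s) else 0) +
  (-1) ^+ p *: insert f (mseq_cons F v) s.
Proof. by []. Qed.

Lemma insert_linF k (F G : seq V -> V) s :
  insert f (fun t => k *: F t + G t) s = k *: insert f F s + insert f G s.
Proof.
elim: s F G => [|v s IH] F G /=; first by rewrite scaler0 addr0.
rewrite IH !scalerDr addrACA !scalerA mulrC; congr (_ + _).
by case: ifP => //; rewrite scaler0 addr0.
Qed.

Lemma insert_mseqP F a c k u w : insert f F (a ++ (k *: u + w) :: c) =
  k *: insert f F (a ++ u :: c) + insert f F (a ++ w :: c).
Proof.
elim: a F => [|v a IH] F.
  rewrite !cat0s !insert_consE mseq_cons_lin insert_linF !scalerDr addrACA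
    !scalerA mulrC.
  congr (_ + _); case: ifP => _; last by rewrite scaler0 addr0.
  by rewrite (on_list_linear f (a := [::])) // (mseqP F [::]).
rewrite !cat_cons !insert_consE IH !scalerDr addrACA !scalerA mulrC.
congr (_ + _); rewrite !size_cat /=; case: ifP => _;
  last by rewrite scaler0 addr0.
have [pa|ap] := leqP p (size a).
  have E z : drop p (a ++ z :: c) = drop p a ++ z :: c.
    rewrite drop_cat; case: ltnP => // ap.
    have -> : p = size a by apply/eqP; rewrite eqn_leq pa ap.
    by rewrite subnn drop0 drop_size.
  have E2 z : on_list f (v :: a ++ z :: c) = on_list f (v :: take p a).
    rewrite -{1}(cat_take_drop p a) -catA -cat_cons on_list_cat //=.
    by rewrite size_takel.
  by rewrite !E !E2 -!(mseqP F (_ :: _)).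
have E z : drop p (a ++ z :: c) = drop (p - size a).-1 c.
  by rewrite drop_cat ltnNge ltnW //= -(subnSK ap).
by rewrite !E -!cat_cons on_list_linear // (mseqP F [::]).
Qed.

Definition mseq_insert F := @Mseq (insert f F) (insert_mseqP F).

Lemma insert_linear : linear mseq_insert.
Proof. by move=> k F G; apply: mseq_ext => s; exact: insert_linF. Qed.

(** Insertion of [f] as an endomorphism of the space of multilinear families. *)
Definition iop : endo mseq := Endo insert_linear.

Lemma iopE F s : iop F s = insert f F s. Proof. by []. Qed.

Lemma iop_nil F : iop F [::] = 0. Proof. by []. Qed.

Lemma iop_cons F v s : iop F (v :: s) =
  (if (p <= size s)%N then F (on_list f (v :: s) :: drop p s) else 0) +
  (-1) ^+ p *: iop (mseq_cons F v) s.
Proof. by []. Qed.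

End OneMap.

Lemma iop_lin p k (f g : multilin V V p.+1) :
  iop (k *: f + g) = k *: iop f + iop g.
Proof.
apply: endo_ext => F; apply: mseq_ext => s; rewrite endoD endoZ mseqD mseqZ.
elim: s F => [|v s IH] F; first by rewrite !iop_nil scaler0 addr0.
rewrite !iop_cons IH !scalerDr addrACA !scalerA mulrC; congr (_ + _).
case: ifP => _; last by rewrite scaler0 addr0.
exact: (mseqP F [::]).
Qed.

Lemma iop0 p : iop (0 : multilin V V p.+1) = 0.
Proof.
have := iop_lin (-1) (0 : multilin V V p.+1) 0.
by rewrite !scaleN1r !addNr.
Qed.

Lemma iopD p (f g : multilin V V p.+1) : iop (f + g) = iop f + iop g.
Proof. by have := iop_lin 1 f g; rewrite !scale1r. Qed.

Lemma iopZ p k (f : multilin V V p.+1) : iop (k *: f) = k *: iop f.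
Proof. by have := iop_lin k f 0; rewrite iop0 !addr0. Qed.

Lemma iopB p (f g : multilin V V p.+1) : iop (f - g) = iop f - iop g.
Proof. by rewrite -scaleN1r iopD iopZ scaleN1r. Qed.

End Insertion.

(** * Insertion operators represent the Gerstenhaber bracket *)

Section PreLie.
Variables (K : fieldType) (V : lmodType K).
Implicit Types (s t u a : seq V) (v : V) (F G : mseq V).

(** The Gerstenhaber composition as a multilinear map.  Its arity [N.+1] is kept
    apart from [p] and [q] so that the compositions in both orders have the same
    type. *)
Definition diamond_mul p q N (eN : N = (p + q)%N) (f : multilin V V p.+1)
    (g : multilin V V q.+1) : multilin V V N.+1 :=
  Multilin (diamond_multilinear f g eN).

Lemma bracketE p q (f : multilin V V p.+1) (g : multilin V V q.+1) :
  bracket f g =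
  diamond_mul (erefl _) f g - (-1) ^+ (p * q) *: diamond_mul (addnC p q) g f.
Proof. exact: multilin_ext. Qed.

Lemma on_list_diamond p q N (eN : N = (p + q)%N) (f : multilin V V p.+1)
    (g : multilin V V q.+1) s : (N < size s)%N ->
  on_list (diamond_mul eN f g) s =
  \sum_(i < p.+1) (-1) ^+ (i * q) *:
    on_list f (take i s ++ on_list g (drop i s) :: drop (i + q.+1) s).
Proof.
move=> ltN; rewrite /on_list /= /diamond; apply: eq_bigr => i _; congr (_ *: _).
have lei : (i <= p)%N by rewrite -ltnS.
have ltis : (i < size s)%N by rewrite (leq_ltn_trans _ ltN) //
  eN (leq_trans lei) ?leq_addr.
congr (Defs.mfun f _); apply/funext => j.
rewrite nth_cat size_takel ?(ltnW ltis) //.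
have lej : (j <= p)%N by rewrite -ltnS.
have [ji|ij|/val_inj ->] := ltngtP j i.
- by rewrite inordK ?nth_take // ltnS eN (leq_trans lej) ?leq_addr.
- rewrite -val_eqE /= (gtn_eqF ij) inordK; last by rewrite ltnS eN leq_add2r.
  rewrite -(subnSK ij) /= nth_drop; congr nth.
  by rewrite addnAC addnS -2!addSn subnKC.
rewrite eqxx subnn /=; congr (Defs.mfun g _); apply/funext => k.
by rewrite inordK ?nth_drop // ltnS eN leq_add // -ltnS.
Qed.

Section TwoMaps.
Variables (p q : nat) (f : multilin V V p.+1) (g : multilin V V q.+1).

(** Insertions of [g] and [f] at disjoint places, that of [g] on the left. *)
Fixpoint insert_disjoint (F : seq V -> V) s : V :=
  if s is v :: s' then
    (if (q <= size s')%N
     then insert f (fun t => F (on_list g s :: t)) (drop q s') else 0) +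
    (-1) ^+ (p + q) *: insert_disjoint (fun t => F (v :: t)) s'
  else 0.

(** Insertion of [g] into a function that applies [f] to the list [a]
    completed by the first [m] entries: either the output of [g] is one of these
    [m] entries, or [g] is inserted after them. *)
Lemma insert_prefix F a m t : (size a + m)%N = p.+1 ->
  insert g (fun u => if (m <= size u)%N
                     then F (on_list f (a ++ u) :: drop m u) else 0) t =
  (if (m + q <= size t)%N then \sum_(i < m) (-1) ^+ (i * q) *:
      F (on_list f (a ++ take i t ++ on_list g (drop i t) :: drop (i + q.+1) t)
           :: drop (m + q) t) else 0) +
  (-1) ^+ (m * q) *: (if (m <= size t)%N then
      insert g (fun u => F (on_list f (a ++ t) :: u)) (drop m t) else 0).
Proof.
elim: m a t => [|m IH] a t.
  rewrite addn0 big_ord0 if_same add0r mul0n scale1r drop0 => sa /=.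
  congr (insert g _ t); apply/funext => u.
  by rewrite drop0 !(on_list_cat _ _ sa).
case: t => [|v t] sa; first by rewrite addSn /= scaler0 addr0.
have E : (fun u => if (m.+1 <= size (v :: u))%N
      then F (on_list f (a ++ v :: u) :: drop m.+1 (v :: u)) else 0) =
    (fun u => if (m <= size u)%N
      then F (on_list f (rcons a v ++ u) :: drop m u) else 0).
  by apply/funext => u; rewrite cat_rcons.
have -> (H : seq V -> V) : insert g H (v :: t) =
  (if (q <= size t)%N then H (on_list g (v :: t) :: drop q t) else 0) +
  (-1) ^+ q *: insert g (fun u => H (v :: u)) t by [].
rewrite E IH; last by rewrite size_rcons -sa addSnnS.
rewrite big_ord_recl /= mul0n scale1r scalerDr addrA scalerA -exprD -mulSn.
rewrite cat_rcons; congr (_ + _).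
rewrite addSn !ltnS; have [lemq|ltmq] := leqP (m + q) (size t); last first.
  rewrite scaler0 addr0; case: ifP => leq_t; last by [].
  by rewrite size_drop leq_subRL // addnC leqNgt ltmq.
have leq_t : (q <= size t)%N := leq_trans (leq_addl _ _) lemq.
rewrite leq_t size_drop leq_subRL // (addnC q) lemq.
rewrite drop_drop; congr (_ + _).
rewrite scaler_sumr; apply: eq_bigr => i _ /=.
by rewrite scalerA -exprD -mulSn cat_rcons.
Qed.

End TwoMaps.

(** Inserting [g] after [f]: into [f], to the left of [f], or to its right. *)
Lemma insert_insert p q N (eN : N = (p + q)%N) (f : multilin V V p.+1)
    (g : multilin V V q.+1) F s :
  insert g (insert f F) s =
  insert (diamond_mul eN f g) F s + (-1) ^+ p *: insert_disjoint f g F s +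
  (-1) ^+ (p * q + q) *: insert_disjoint g f F s.
Proof.
elim: s F => [|v s IH] F; first by rewrite /= !scaler0 !addr0.
have E : insert g (insert f F) (v :: s) =
  (if (q <= size s)%N
   then insert f F (on_list g (v :: s) :: drop q s) else 0) +
  (-1) ^+ q *: insert g (fun t => (-1) ^+ p *: insert f (mseq_cons F v) t +
     (if (p <= size t)%N then F (on_list f ([:: v] ++ t) :: drop p t) else 0))
       s.
  congr (_ + _ *: _); congr (insert g _ s).
  by apply/funext => t; rewrite addrC.
rewrite {}E insert_linF IH insert_prefix // {IH}.
have D p' q' (f' : multilin V V p'.+1) (g' : multilin V V q'.+1) :
  insert_disjoint f' g' F (v :: s) =
  (if (q' <= size s)%N
   then insert f' (fun t => F (on_list g' (v :: s) :: t)) (drop q' s) else 0) +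
  (-1) ^+ (p' + q') *: insert_disjoint f' g' (mseq_cons F v) s by [].
rewrite !insert_consE !{}D size_drop drop_drop.
set B := insert f _ (drop q s); set C := insert g _ (drop p s).
have -> (b : bool) (y z : V) :
  (if b then y + z else 0) = (if b then y else 0) + (if b then z else 0).
  by case: b; rewrite ?addr0.
have -> (b : bool) (z : V) :
  (if b then (-1) ^+ p *: z else 0) = (-1) ^+ p *: (if b then z else 0).
  by case: b; rewrite ?scaler0.
have -> : (if (q <= size s)%N then if (p <= size s - q)%N then
    F (on_list f (on_list g (v :: s) :: drop q s) :: drop (p + q) s)
    else 0 else 0) = (if (p + q <= size s)%N then
    F (on_list f (on_list g (v :: s) :: drop q s) :: drop (p + q) s) else 0).
  case: (leqP q (size s)) => [qs|sq]; first by rewrite leq_subRL // addnC.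
  by rewrite leqNgt (leq_trans sq) ?leq_addl.
set A := (if (p + q <= _)%N then F _ else 0);
  set S := (if (p + q <= _)%N then _ else _).
have -> : (if (N <= size s)%N
    then F (on_list (diamond_mul eN f g) (v :: s) :: drop N s) else 0) =
    A + (-1) ^+ q *: S.
  rewrite /A /S -eN; case: ifP => Ns; last by rewrite scaler0 addr0.
  rewrite on_list_diamond // big_ord_recl mul0n scale1r.
  rewrite (mseq_entryD F [::]); congr (F (on_list f (_ :: _) :: _) + _).
  rewrite cat0s.
  have -> (n : nat) (y : 'I_n -> V) c : F ((\sum_i y i) :: c) = \sum_i F
    (y i :: c).
    elim/big_rec2: _ => [|i y1 y2 _ <-]; first exact: (mseq_entry0 F [::]).
    exact: (mseq_entryD F [::]).
  rewrite scaler_sumr; apply: eq_bigr => i _.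
  by rewrite (mseq_entryZ F [::]) scalerA -exprD -mulSn.
set X := insert (diamond_mul _ _ _) _ _.
clearbody A S B C X; rewrite !scalerDr !scalerA -!exprD eN.
rewrite [LHS](AC (2*(3*2)) ((1*6*3*(2*4))*(7*5))).
congr (_ + _ + _ *: _ + (_ + _ *: _) + (_ *: _ + _ *: _)).
all: congr (_ ^+ _).
- exact: addnC.
- by rewrite (addnC q) addnC.
- exact: addnC.
- by rewrite addnC.
Qed.

(** The right action of [f] and then of [g] differs from that of their
    composition by a term that is graded symmetric in [f] and [g], so that the
    graded commutator of the two actions is the action of the bracket. *)
Lemma iop_bracket p q (f : multilin V V p.+1) (g : multilin V V q.+1) :
  iop (bracket f g) = iop f * iop g - (-1) ^+ (p * q) *: (iop g * iop f).
Proof.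
rewrite bracketE iopB iopZ.
apply: endo_ext => F; apply: mseq_ext => s.
rewrite !(endoD, endoN, endoZ) !(mseqD, mseqN, mseqZ) !endoM.
rewrite [iop g _ s](insert_insert (erefl _)) [iop f _ s](insert_insert
  (addnC p q)).
rewrite -!iopE; set X := iop _ F s; set Y := iop _ F s.
set Z := insert_disjoint _ _ _ _; set W := insert_disjoint _ _ _ _.
rewrite !scalerDr !scalerA -!exprD (mulnC q p).
have -> : (-1) ^+ (p * q + (p * q + p)) = (-1) ^+ p :> K.
  by rewrite addnA addnn exprD -signr_odd odd_double mul1r.
rewrite !opprD.
rewrite [RHS](AC (3*3) ((1*4)*((2*6)*(3*5)))) /=.
by rewrite !subrr !addr0.
Qed.

Fact mseq_id_subproof a (c : seq V) (k : K) (u w : V) :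
  (if a ++ (k *: u + w) :: c is [:: v] then v else 0) =
  k *: (if a ++ u :: c is [:: v] then v else 0) +
  (if a ++ w :: c is [:: v] then v else 0).
Proof.
case: a => [|? [|? ?]] /=; last by rewrite scaler0 addr0.
  by case: c => //; rewrite scaler0 addr0.
by rewrite scaler0 addr0.
Qed.
(** The identity map in arity one. *)
Definition mseq_id : mseq V :=
  @Mseq _ _ (fun s => if s is [:: v] then v else 0) mseq_id_subproof.

(** On the identity, the operator of [f] returns [f], placed in its arity. *)
Lemma iop_id p (f : multilin V V p.+1) s :
  iop f mseq_id s = if size s == p.+1 then on_list f s else 0.
Proof.
have Z F t : (forall u, u != [::] -> F u = 0) -> iop f F t = 0.
  elim: t F => // v t IH F F0; rewrite iop_cons F0 // if_same add0r.
  by rewrite IH ?scaler0 // => u _; rewrite mseq_consE F0.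
case: s => // v s; rewrite iop_cons Z ?scaler0 ?addr0; last by case.
rewrite /= eqSS; case: ltngtP => // [ps|ps].
  by case E : (drop p s) => [|u t] //; move: ps; rewrite -subn_gt0 -size_drop E.
by rewrite drop_oversize ?ps.
Qed.

Lemma on_list_enum n (h : multilin V V n) (v : 'I_n -> V) :
  on_list h [seq v i | i <- enum 'I_n] = h v.
Proof.
case: n h v => [|n] h v; congr (Defs.mfun h _); apply/funext => i;
  first by case: i.
by rewrite (nth_map ord0) ?size_enum_ord // nth_ord_enum.
Qed.

(** A multilinear map is determined by the action of its operator on the
    identity. *)
Lemma iop_id_inj p (f g : multilin V V p.+1) :
  iop f mseq_id = iop g mseq_id -> f = g.
Proof.
move=> fg; apply: multilin_ext => v.
have := congr1 (fun F : mseq V => F [seq v i | i <- enum 'I_p.+1]) fg.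
by rewrite !iop_id size_map size_enum_ord eqxx !on_list_enum.
Qed.

(** Maps of propositionally equal arities with the same values on lists have the
    same operator. *)
Lemma iop_eq p p' (f : multilin V V p.+1) (g : multilin V V p'.+1) : p = p' ->
  (forall s, (p < size s)%N -> on_list f s = on_list g s) -> iop f = iop g.
Proof.
move=> pp'; subst p' => fg; apply: endo_ext => F; apply: mseq_ext => s.
elim: s F => // v s IH F; rewrite !iop_cons IH; congr (_ + _).
by case: ifP => // ps; rewrite fg.
Qed.

Lemma insert_comp p (f : multilin V V p.+1) (L : V -> V) (F : seq V -> V) s :
  linear L -> insert f (fun t => L (F t)) s = L (insert f F s).
Proof.
move=> linL; have L0 : L 0 = 0 by have := linL (-1) 0 0;
  rewrite !scaleN1r !addNr.
elim: s F => //= v s IH F; rewrite IH [in RHS]addrC linL addrC.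
by congr (_ + _); case: ifP.
Qed.

Lemma multilin0 (U W : lmodType K) n (f : multilin U W n) (v : 'I_n -> U) i :
  v i = 0 -> f v = 0.
Proof.
move=> vi; have -> : v = update v i ((-1) *: 0 + 0).
  by apply/funext => j; rewrite /update; case: eqP => // ->;
    rewrite scaler0 addr0.
by rewrite mfunP scaleN1r addNr.
Qed.

End PreLie.

Arguments mseq_id {K V}.

(** * Iterated graded commutators *)

Lemma sign_eq (K : fieldType) m n : odd m = odd n -> (-1) ^+ m = (-1) ^+ n :> K.
Proof. by move=> mn; rewrite -signr_odd mn signr_odd. Qed.

Section IteratedBrackets.
Variables (K : fieldType) (U : lmodType K).
Local Notation R := (endo U).
(* Homogeneous operators come with their degree. *)
Implicit Types (x y : nat * R) (xs ys : seq (nat * R)) (S T P Q : R).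

(** The graded commutator of [S] of degree [m] and [T] of degree [n]. *)
Definition gcomm m n S T : R := S * T - (-1) ^+ (m * n) *: (T * S).

(** [[..[[T, x_1], x_2], ..], x_k] for [T] of degree [b]. *)
Fixpoint ibr b T xs : R :=
  if xs is x :: xs' then ibr (b + x.1)%N (gcomm b x.1 T x.2) xs' else T.

(** The total degree of a list of homogeneous operators. *)
Definition degs xs : nat := sumn (map fst xs).

Lemma gcomm_linl m n k S T P :
  gcomm m n (k *: S + T) P = k *: gcomm m n S P + gcomm m n T P.
Proof.
rewrite /gcomm mulrDl mulrDr -endo_scalerAl -endo_scalerAr !scalerDr !scalerN.
by rewrite !scalerA (mulrC k) opprD addrACA.
Qed.

Lemma gcomm_linr m n k S T P :
  gcomm m n P (k *: S + T) = k *: gcomm m n P S + gcomm m n P T.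
Proof.
rewrite /gcomm mulrDl mulrDr -endo_scalerAl -endo_scalerAr !scalerDr !scalerN.
by rewrite !scalerA (mulrC k) opprD addrACA.
Qed.

Lemma ibr_lin b k S T xs : ibr b (k *: S + T) xs = k *: ibr b S xs + ibr b T xs.
Proof. by elim: xs b S T => //= x xs IH b S T; rewrite gcomm_linl IH. Qed.

Lemma ibr0 b xs : ibr b 0 xs = 0.
Proof. by have := ibr_lin b (-1) 0 0 xs; rewrite !scaleN1r !addNr. Qed.

Lemma ibrD b S T xs : ibr b (S + T) xs = ibr b S xs + ibr b T xs.
Proof. by have := ibr_lin b 1 S T xs; rewrite !scale1r. Qed.

Lemma ibrZ b k S xs : ibr b (k *: S) xs = k *: ibr b S xs.
Proof. by have := ibr_lin b k S 0 xs; rewrite ibr0 !addr0. Qed.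

Lemma ibr_sum b (I : Type) (r : seq I) (F : I -> R) xs :
  ibr b (\sum_(i <- r) F i) xs = \sum_(i <- r) ibr b (F i) xs.
Proof.
by apply: (big_morph (fun T => ibr b T xs)) => [S T|]; rewrite ?ibrD ?ibr0.
Qed.

Lemma ibr_cat b T xs ys :
  ibr b T (xs ++ ys) = ibr (b + degs xs)%N (ibr b T xs) ys.
Proof.
elim: xs b T => [|x xs IH] b T; first by rewrite /degs /= addn0.
by rewrite [LHS]/= IH -addnA.
Qed.

Lemma ibr_entry0 b T xs n ys : ibr b T (xs ++ (n, 0) :: ys) = 0.
Proof.
by rewrite ibr_cat /= /gcomm mulr0 mul0r scaler0 subr0 ibr0.
Qed.

(** All boolean masks of length [n], that is, all ways to split a list of length
    [n] into a selected sublist and its complement. *)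
Fixpoint masks n : seq bitseq :=
  if n is n'.+1 then map (cons true) (masks n') ++ map (cons false) (masks n')
  else [:: [::]].

Lemma masksS n :
  masks n.+1 = map (cons true) (masks n) ++ map (cons false) (masks n).
Proof. by []. Qed.

Lemma big_masksS (W : nmodType) n (H : bitseq -> W) :
  \sum_(m <- masks n.+1) H m =
  \sum_(m <- masks n) H (true :: m) + \sum_(m <- masks n) H (false :: m).
Proof. by rewrite big_cat !big_map. Qed.

Lemma mem_masks n m : (m \in masks n) = (size m == n).
Proof.
elim: n m => [|n IH] m; first by rewrite inE size_eq0.
have cons_inj b : injective (cons b : bitseq -> bitseq) by move=> ? ? [].
rewrite masksS mem_cat; case: m => [|b m].
  by apply/norP; split; apply/mapP => -[].
have E (c : bool) : (b :: m \in map (cons c) (masks n)) = (b == c) &&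
  (m \in masks n).
  case: eqP => [->|bc]; first exact: mem_map.
  by apply/mapP => -[m' _ []].
by rewrite !E IH -[(size (b :: m) == _)]/(size m == n); case: b {E};
  rewrite /= ?orbF.
Qed.

Lemma uniq_masks n : uniq (masks n).
Proof.
have cons_inj b : injective (cons b : bitseq -> bitseq) by move=> ? ? [].
elim: n => // n IH; rewrite masksS cat_uniq !map_inj_uniq // IH andbT /=.
by apply/hasPn => _ /mapP[m _ ->]; apply/mapP => -[].
Qed.

Lemma big_masks_negb (W : nmodType) n (H : bitseq -> W) :
  \sum_(m <- masks n) H (map negb m) = \sum_(m <- masks n) H m.
Proof.
elim: n H => [|n IH] H; first by rewrite !big_seq1.
rewrite !big_masksS addrC.
by rewrite (IH (fun m => H (true :: m))) (IH (fun m => H (false :: m))).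
Qed.

(** Koszul sign of moving the entries selected by the mask to the front, keeping
    the order of the selected entries and of the others. *)
Fixpoint msign (m : bitseq) xs : K :=
  match m, xs with
  | true :: m', x :: xs' => msign m' xs'
  | false :: m', x :: xs' => (-1) ^+ (x.1 * degs (mask m' xs')) * msign m' xs'
  | _, _ => 1
  end.

Lemma msign_negb m xs : size m = size xs ->
  msign (map negb m) xs =
  (-1) ^+ (degs (mask m xs) * degs (mask (map negb m) xs)) * msign m xs.
Proof.
elim: m xs => [|b m IH] [|x xs] //=; first by rewrite mul1r.
case: b => -[/IH E] /=; rewrite E mulrA -?exprD /degs /= -!/(degs _).
  by rewrite -mulnDl.
by congr (_ * _); apply: sign_eq; rewrite !(oddD, oddM); do 3!case: (odd _).
Qed.

(** The graded commutator with [X] is a derivation of the product. *)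
Lemma gcommM p q n P Q X :
  gcomm (p + q)%N n (P * Q) X =
  P * gcomm q n Q X + (-1) ^+ (q * n) *: (gcomm p n P X * Q).
Proof.
rewrite /gcomm mulrBr mulrBl scalerBr -endo_scalerAr -endo_scalerAl scalerA.
by rewrite -exprD -mulnDl (addnC q) !mulrA addrA subrK.
Qed.

(** Iterated graded Leibniz rule. *)
Lemma ibrM p q P Q xs :
  ibr (p + q)%N (P * Q) xs =
  \sum_(m <- masks (size xs)) (msign m xs * (-1) ^+ (q * degs (mask m xs))) *:
     (ibr p P (mask m xs) * ibr q Q (mask (map negb m) xs)).
Proof.
elim: xs p q P Q => [|x xs IH] p q P Q.
  by rewrite big_seq1 /= mul1r muln0 scale1r.
rewrite [LHS]/= gcommM ibrD ibrZ -{1}addnA addnAC !IH big_masksS addrC.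
congr (_ + _).
  rewrite scaler_sumr; apply: eq_bigr => m _; rewrite scalerA /=.
  by rewrite mulrCA -exprD -mulnDr.
apply: eq_bigr => m _ /=; congr (_ *: _).
by rewrite mulnDl exprD -[RHS]mulrA [RHS]mulrCA; congr (_ * _); exact: mulrC.
Qed.

(** [x] and [y] commute in the graded sense. *)
Definition gcommutes x y : Prop :=
  x.2 * y.2 = (-1) ^+ (x.1 * y.1) *: (y.2 * x.2).

Lemma gcommutes0 x y : gcommutes x y -> gcomm x.1 y.1 x.2 y.2 = 0.
Proof. by rewrite /gcomm => ->; rewrite subrr. Qed.

(** The graded Jacobi identity for two commuting entries. *)
Lemma gcomm_swap b T x y : gcommutes x y ->
  gcomm (b + x.1)%N y.1 (gcomm b x.1 T x.2) y.2 =
  (-1) ^+ (x.1 * y.1) *: gcomm (b + y.1)%N x.1 (gcomm b y.1 T y.2) x.2.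
Proof.
case: x y => [m X] [n Y]; rewrite /gcommutes /gcomm /= => XY.
rewrite !mulrBr !mulrBl !scalerBr -!endo_scalerAl -!endo_scalerAr !scalerA
  !opprB.
rewrite -!mulrA XY -!endo_scalerAr.
rewrite [X * (Y * T)]mulrA XY -endo_scalerAl -mulrA scalerA -!exprD.
rewrite [LHS](AC (2*2) (1*4*(3*2))) /=.
by congr (_ - _ *: _ + (_ *: _ - _ *: _)); apply: sign_eq;
  rewrite !(oddD, oddM); case: (odd b); case: (odd m); case: (odd n).
Qed.

(** An entry that commutes with all later ones may be moved to the end. *)
Lemma ibr_cons b T x xs : (forall y, y \in xs -> gcommutes x y) ->
  ibr b T (x :: xs) =
  (-1) ^+ (x.1 * degs xs) *: gcomm (b + degs xs)%N x.1 (ibr b T xs) x.2.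
Proof.
elim: xs b T => [|y xs IH] b T xC; first by rewrite /= muln0 scale1r addn0.
have yC : gcommutes x y by apply: xC; rewrite mem_head.
rewrite [LHS]/= gcomm_swap // ibrZ addnAC -[ibr _ _ xs]/(ibr _ _ (x :: xs)).
rewrite IH => [|z zxs]; last by apply: xC; rewrite in_cons zxs orbT.
by rewrite scalerA -exprD -mulnDr -addnA.
Qed.

(** An entry that commutes with all earlier ones may be moved to the front. *)
Lemma ibr_front b T xs x ys : (forall y, y \in xs -> gcommutes y x) ->
  ibr b T (xs ++ x :: ys) = (-1) ^+ (x.1 * degs xs) *: ibr b T (x :: xs ++ ys).
Proof.
elim: xs b T => [|y xs IH] b T xC; first by rewrite /= muln0 scale1r.
rewrite [LHS]/= IH => [|z zxs]; last by apply: xC; rewrite in_cons zxs orbT.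
rewrite [ibr _ _ (_ :: _)]/= gcomm_swap; last by apply: xC; rewrite mem_head.
rewrite ibrZ scalerA -exprD mulnC addnC (mulnC y.1) /degs /= mulnDr
  [(x.1 * y.1)%N]mulnC.
by rewrite addnAC (mulnC x.1).
Qed.

End IteratedBrackets.

(** * Higher Jacobi identities from a square-zero operator *)

Section HigherJacobi.
Variables (K : fieldType) (U : lmodType K).
Local Notation R := (endo U).
(** [H] is a graded commutative set of homogeneous operators and [Delta i] is
    the part of the structure operator of which the [i]-fold commutators with
    elements of [H] return to [H]. *)
Variables (H : nat * R -> Prop) (Delta : nat -> R).
Hypothesis H_comm : forall x y, H x -> H y -> gcommutes x y.
Hypothesis H_closed : forall i (xs : seq (nat * R)),
  (forall x, x \in xs -> H x) -> size xs = i ->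
  H ((1 + degs xs)%N, ibr 1 (Delta i) xs).

Implicit Types xs : seq (nat * R).

Lemma ibr_vanish i xs : (forall x, x \in xs -> H x) -> (i < size xs)%N ->
  ibr 1 (Delta i) xs = 0.
Proof.
move=> xsH ltis; rewrite -(cat_take_drop i xs) ibr_cat (drop_nth (0%N, 0) ltis)
  /=.
have Hx : H (nth (0%N, 0) xs i) by apply/xsH/mem_nth.
have := @H_closed i (take i xs); rewrite size_takel 1?ltnW //
  => /(_ _ erefl) Ht.
rewrite (gcommutes0 (H_comm (Ht _) Hx)) ?ibr0 // => x xt.
by apply: xsH; rewrite -(cat_take_drop i xs) mem_cat xt.
Qed.

Lemma count_negb (m : bitseq) : (count id (map negb m) = size m - count id m)%N.
Proof.
by rewrite count_map -(count_predC id m) addKn; apply: eq_count; case.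
Qed.

(** The higher Jacobi identity, as a sum over the splittings of [xs] into the
    entries of the inner and those of the outer operation. *)
Lemma higher_jacobi xs : (forall x, x \in xs -> H x) ->
  \sum_(i < (size xs).+2) Delta i * Delta ((size xs).+1 - i) = 0 ->
  \sum_(m <- masks (size xs)) msign m xs *:
    ibr 1 (Delta ((size xs).+1 - count id m))
      (((1 + degs (mask m xs))%N, ibr 1 (Delta (count id m)) (mask m xs))
         :: mask (map negb m) xs) = 0.
Proof.
set N := size xs => xsH sq0.
pose nT (m : bitseq) := map negb m.
pose l i m := ibr 1 (Delta i) (mask m xs).
pose d m := degs (mask m xs).
have maskH m x : x \in mask m xs -> H x by move/mem_mask/xsH.
have sizeT m : size m = N -> size (mask (nT m) xs) = (N - count id m)%N.
  by move=> sm; rewrite size_mask ?size_map // count_negb sm.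
transitivity (\sum_(m <- masks N) msign m xs *: (
    (-1) ^+ d m *: (l (count id m) m * l (N.+1 - count id m)%N (nT m)) +
    (-1) ^+ (d m * d (nT m) + d (nT m)) *:
      (l (N.+1 - count id m)%N (nT m) * l (count id m) m))).
  (* each term is a graded commutator of the inner operation, moved past the
     entries of the outer one *)
  apply: eq_big_seq => m; rewrite mem_masks => /eqP sm; congr (_ *: _).
  have bH : H ((1 + d m)%N, l (count id m) m).
    by apply: H_closed => [x /maskH //|]; rewrite size_mask // sm.
  rewrite ibr_cons => [|y /maskH yH]; last exact: H_comm.
  rewrite /gcomm scalerBr addrC scalerA -exprD -scaleNr.
  congr (_ *: _ + _ *: _).
    rewrite -mulN1r -exprS; apply: sign_eq; rewrite /d /nT.
    by rewrite !(oddD, oddM, oddS) /=; do 2!case: (odd _).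
  by apply: sign_eq; rewrite /d /nT !(oddD, oddM) /=; do 2!case: (odd _).
transitivity (\sum_(m <- masks N) (msign m xs * (-1) ^+ d m) *:
    (l (count id m) m * l (N.+1 - count id m)%N (nT m) +
     l (count id m).+1 m * l (N - count id m)%N (nT m))).
  (* exchange the two halves of the splitting in the second family of terms *)
  under eq_bigr do rewrite scalerDr.
  under [RHS]eq_bigr do rewrite scalerDr.
  rewrite !big_split /=; congr (_ + _); first by apply: eq_bigr => m _;
    rewrite scalerA.
  rewrite -[LHS]big_masks_negb; apply: eq_big_seq => m;
    rewrite mem_masks => /eqP sm.
  have nTK : nT (nT m) = m by rewrite /nT -map_comp map_id_in // => b _;
    exact: negbK.
  rewrite -/(nT m) nTK scalerA msign_negb // count_negb sm.
  rewrite subSn ?leq_subr // subKn; last by rewrite -sm count_size.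
  congr (_ *: _); rewrite mulrAC -exprD mulrC; congr (_ * _).
  by apply: sign_eq; rewrite /d /nT !(oddD, oddM) /=; do 2!case: (odd _).
transitivity (ibr 2 (\sum_(i < N.+2) Delta i * Delta (N.+1 - i)%N) xs);
  last by rewrite sq0 ibr0.
rewrite ibr_sum.
under [RHS]eq_bigr do rewrite (ibrM 1 1).
rewrite exchange_big /=. apply: eq_big_seq => m; rewrite mem_masks => /eqP sm.
rewrite -scaler_sumr mul1n; congr (_ *: _).
(* only i = |S| and i = |S| + 1 contribute, S being the selected part *)
have cN : (count id m <= N)%N by rewrite -sm count_size.
have c2 : (count id m < N.+2)%N by rewrite ltnS leqW.
have c3 : ((count id m).+1 < N.+2)%N by rewrite !ltnS.
rewrite (bigD1 (Ordinal c2)) //= (bigD1 (Ordinal c3)) /=; last first.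
  by rewrite -val_eqE /= gtn_eqF.
rewrite subSS big1 ?addr0 // => i /andP[ic ic1].
have [im|mi] := ltnP i (count id m).
  by rewrite (ibr_vanish (@maskH m)) ?mul0r // size_mask.
rewrite [X in _ * X](ibr_vanish (@maskH (nT m))) ?mulr0 // sizeT //.
have {}ic1 : ((count id m).+1 < i)%N.
  by rewrite ltn_neqAle (eq_sym _ (i : nat)) ic1 ltn_neqAle
    (eq_sym _ (i : nat)) ic mi.
by rewrite -(subSS (count id m) N) ltn_sub2l // (leq_trans ic1) // -ltnS.
Qed.

End HigherJacobi.

(** * Koszul signs and shuffles *)

Section Shuffles.
Variables (K : fieldType) (N : nat).
Implicit Types (s : 'S_N.+1) (i j u : 'I_N.+1) (w : seq 'I_N.+1) (m : bitseq).

Let lt_ord : rel 'I_N.+1 := relpre val ltn.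
Local Notation E := (enum 'I_N.+1).

Let lt_ord_trans : transitive lt_ord.
Proof. by move=> j i u; apply: ltn_trans. Qed.
Let lt_ord_irr : irreflexive lt_ord.
Proof. by move=> i; apply: ltnn. Qed.

Lemma sorted_enum_ord : sorted lt_ord E.
Proof. by rewrite -sorted_map val_enum_ord iota_ltn_sorted. Qed.

Lemma enum_ord_iota : E = map (@inord N) (iota 0 N.+1).
Proof.
rewrite -val_enum_ord -map_comp -[LHS]map_id; apply: eq_map => i /=.
by rewrite inord_val.
Qed.

Variable n : 'I_N.+1 -> nat.

(** Koszul sign of sorting a list of indices, the index [i] having degree
    [n i]. *)
Fixpoint sort_sign w : K :=
  if w is i :: w' then
    (\prod_(j <- w' | (j < i)%N) (-1) ^+ (n i * n j)) * sort_sign w'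
  else 1.

Lemma sort_sign_map s w : sorted lt_ord w ->
  \prod_(i <- w) \prod_(j <- w | (i < j)%N && (s j < s i)%N)
    (-1) ^+ (n (s i) * n (s j)) = sort_sign (map s w).
Proof.
elim: w => [|i w IH] /=; first by rewrite big_nil.
rewrite path_sortedE // => /andP[/allP iw /IH {IH} <-].
rewrite big_cons big_cons /= ltnn /= big_map; congr (_ * _).
  rewrite big_seq_cond [RHS]big_seq_cond; apply: eq_bigl => j.
  by case: (boolP (j \in w)) => // /iw; rewrite /lt_ord /= => ->.
apply: eq_big_seq => j /iw; rewrite /lt_ord /= => ij.
by rewrite big_cons ltnNge (ltnW ij).
Qed.

(** The Koszul sign of a permutation is that of sorting its list of values.
    Only the parities of the degrees matter, so that integer degrees may be
    replaced by their absolute values. *)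
Lemma koszul_sort_sign s (d : 'I_N.+1 -> int) :
  (forall i, n i = `|d i|%N) -> koszul K s d = sort_sign (map s E).
Proof.
move=> nd; have zsign (a b : int) : (-1) ^ (a * b) = (-1) ^+ (`|a| * `|b|) :> K.
  by rewrite -abszM; case: (a * b) => k //=; rewrite /exprz invr_sign.
rewrite -sort_sign_map ?sorted_enum_ord // big_enum; apply: eq_bigr => i _.
by rewrite big_enum_cond; apply: eq_bigr => j _; rewrite zsign !nd.
Qed.

Lemma sort_sign_insert w1 i w2 :
  (forall j, j \in w1 -> (i < j)%N) -> (forall j, j \in w2 -> (i < j)%N) ->
  sort_sign (w1 ++ i :: w2) =
  (-1) ^+ (n i * sumn (map n w1)) * sort_sign (w1 ++ w2).
Proof.
move=> iw1 iw2; elim: w1 iw1 => [|j w1 IH] iw1 /=.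
  rewrite muln0 big_seq_cond big1 // => j /andP[/iw2 ij].
  by rewrite ltnNge (ltnW ij).
rewrite IH => [|k kw]; last by apply: iw1; rewrite in_cons kw orbT.
rewrite !big_cat big_cons /= iw1 ?mem_head // mulnDr exprD (mulnC (n j)).
rewrite [X in X * _ = _]mulrCA -!mulrA; congr (_ * _).
by rewrite [RHS]mulrCA; congr (_ * _); rewrite mulrCA.
Qed.

(** The sign contributed by the head [i] of a list when it is moved to its place
    in the sorted list. *)
Lemma sort_sign_place w1 i w2 w : sorted lt_ord (w1 ++ i :: w2) ->
  perm_eq w (w1 ++ w2) ->
  \prod_(j <- w | (j < i)%N) (-1) ^+ (n i * n j) =
  (-1) ^+ (n i * sumn (map n w1)) :> K.
Proof.
rewrite sorted_pairwise // pairwise_cat /= => /and3P[/allrelP w1i _].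
case/andP=> /allP iw2 _ pw; rewrite (perm_big _ pw) big_cat /=.
rewrite [X in _ * X]big_seq_cond [X in _ * X]big1 ?mulr1 => [|j /andP[/iw2]];
  last first.
  by rewrite /lt_ord /= => ij; rewrite ltnNge (ltnW ij).
elim: w1 w1i {pw} => [|j w1 IH] w1i; first by rewrite big_nil muln0.
have ji : (j < i)%N by apply: w1i; rewrite ?mem_head.
rewrite big_cons ji IH => [|k l kw]; last by apply: w1i;
  rewrite in_cons kw orbT.
by rewrite -exprD -mulnDr.
Qed.

Section Operators.
Variables (U : lmodType K) (X : 'I_N.+1 -> endo U).
Let it i := (n i, X i).

Lemma degs_map w : degs (map it w) = sumn (map n w).
Proof. by rewrite /degs -map_comp. Qed.

(** Iterated commutators of graded commuting operators are graded symmetric. *)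
Lemma ibr_sort b T w (v : seq 'I_N.+1) :
  (forall i j, gcommutes (it i) (it j)) ->
  perm_eq w v -> sorted lt_ord v ->
  ibr b T (map it w) = sort_sign w *: ibr b T (map it v).
Proof.
move=> itC; elim: w v b T => [|i w IH] v b T.
  by rewrite perm_sym => /perm_nilP-> _; rewrite scale1r.
move=> pwv srtv; have iv : i \in v by rewrite -(perm_mem pwv) mem_head.
case/splitPr: v / iv pwv srtv => v1 v2 pwv srtv.
have {}pwv : perm_eq w (v1 ++ v2).
  by rewrite -(perm_cons i) (perm_trans pwv) // -cat1s perm_catCA.
have srt12 : sorted lt_ord (v1 ++ v2).
  by apply: subseq_sorted srtv => //; rewrite cat_subseq ?subseq_cons.
rewrite map_cat /= ibr_front => [|_ /mapP[j _ ->]]; last exact: itC.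
rewrite (sort_sign_place srtv pwv) scalerA degs_map mulrAC -exprD addnn.
rewrite -signr_odd odd_double mul1r /=.
by rewrite (IH _ _ _ pwv srt12) map_cat.
Qed.

(** The Koszul sign of a shuffle is that of the corresponding splitting. *)
Lemma sort_sign_mask m w : size m = size w -> sorted lt_ord w ->
  sort_sign (mask m w ++ mask (map negb m) w) = msign m (map it w).
Proof.
elim: m w => [|b m IH] [|i w] //= [smw];
  rewrite path_sortedE // => /andP[/allP iw srtw].
case: b => /=; last first.
  rewrite sort_sign_insert; try by move=> j /mem_mask/iw.
  by rewrite IH // -map_mask degs_map.
rewrite IH // big_seq_cond big1 ?mul1r // => j /andP[].
rewrite mem_cat => /orP[] /mem_mask/iw; rewrite /lt_ord /= => ij;
  by rewrite ltnNge (ltnW ij).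
Qed.

End Operators.

Lemma perm_mask_negb (T : eqType) (r : seq T) m : size m = size r ->
  perm_eq (mask m r ++ mask (map negb m) r) r.
Proof.
elim: m r => [|b m IH] [|x r] //= [smr]; case: b => /=.
  by rewrite perm_cons IH.
by rewrite -cat1s perm_catCA /= perm_cons IH.
Qed.

(** The mask that selects the images under [s] of the first [k] indices; it
    determines [s] if [s] is a shuffle. *)
Definition shuffle_mask k s : bitseq := [seq (s^-1%g u < k)%N | u <- E].

(** A shuffle lists the selected indices, and then the others, in increasing
    order. *)
Lemma shuffle_maskE k s : (k <= N.+1)%N -> s \in shuffles N.+1 k ->
  map (fun t => s (inord t)) (iota 0 k) = mask (shuffle_mask k s) E /\
  map (fun t => s (inord t)) (iota k (N.+1 - k)) =
    mask (map negb (shuffle_mask k s)) E.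
Proof.
move=> lek; rewrite inE => /forallP shs.
have mono a b : (a < b < N.+1)%N -> (b < k)%N || (k <= a)%N ->
    lt_ord (s (inord a)) (s (inord b)).
  case/andP=> ab bN abk; have aN := ltn_trans ab bN.
  have /forallP/(_ (inord b))/implyP := shs (inord a); apply.
  by rewrite !inordK // ab.
split; apply: (irr_sorted_eq lt_ord_trans lt_ord_irr).
- apply: (@homo_sorted_in _ _ (fun t => (t < k)%N) _ ltn) => [a b ak bk ab| |].
  + by apply: mono; rewrite ?[(b < k)%N]bk //
    (ab : (a < b)%N) (leq_trans _ lek).
  + by apply/allP => t; rewrite mem_iota.
  + exact: iota_ltn_sorted.
- exact/sorted_mask/sorted_enum_ord.
- move=> u; rewrite -filter_mask mem_filter mem_enum andbT.
  apply/mapP/idP => [[t]|uk].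
    rewrite mem_iota => /andP[_ tk] ->; rewrite permK inordK //.
    exact: leq_trans lek.
  by exists (val (s^-1%g u)); rewrite ?mem_iota // inord_val permKV.
- apply: (@homo_sorted_in _ _ (fun t => (k <= t < N.+1)%N) _ ltn) => [a b| |].
  + move=> /andP[ka aN] /andP[kb bN] ab.
    by apply: mono; rewrite ?ka ?orbT // (ab : (a < b)%N).
  + by apply/allP => t; rewrite mem_iota subnKC.
  + exact: iota_ltn_sorted.
- exact/sorted_mask/sorted_enum_ord.
move=> u; rewrite -map_comp -filter_mask mem_filter mem_enum andbT /=.
rewrite -leqNgt; apply/mapP/idP => [[t]|ku].
  by rewrite mem_iota subnKC // => /andP[kt tN] ->; rewrite permK inordK.
exists (val (s^-1%g u)); last by rewrite inord_val permKV.
by rewrite mem_iota subnKC // ku ltn_ord.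
Qed.

Lemma shuffle_enum k s : (k <= N.+1)%N -> s \in shuffles N.+1 k ->
  map s E = mask (shuffle_mask k s) E ++ mask (map negb (shuffle_mask k s)) E.
Proof.
move=> lek /(shuffle_maskE lek)[<- <-]; rewrite -map_cat.
by rewrite -[X in iota X (_ - _)]add0n -iotaD subnKC // enum_ord_iota -map_comp.
Qed.

Lemma size_shuffle_mask k s : size (shuffle_mask k s) = N.+1.
Proof. by rewrite size_map size_enum_ord. Qed.

Lemma count_shuffle_mask k s : (k <= N.+1)%N -> s \in shuffles N.+1 k ->
  count id (shuffle_mask k s) = k.
Proof.
move=> lek /(shuffle_maskE lek)[/(congr1 size) + _].
by rewrite size_map size_iota size_mask // size_map.
Qed.

Lemma shuffle_mask_inj k : (k <= N.+1)%N ->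
  {in shuffles N.+1 k &, injective (shuffle_mask k)}.
Proof.
move=> lek s s' shs shs' ss'; apply/permP => i.
have : map s E = map s' E by rewrite !(shuffle_enum lek) // ss'.
by move/eq_in_map; apply; rewrite mem_enum.
Qed.

Lemma shuffle_mask_surj k m : size m = N.+1 -> count id m = k ->
  exists2 s, s \in shuffles N.+1 k & shuffle_mask k s = m.
Proof.
move=> sm cm; pose S := mask m E; pose T := mask (map negb m) E.
have sE : size E = N.+1 by rewrite size_enum_ord.
have pST : perm_eq (S ++ T) E by apply: perm_mask_negb; rewrite sE.
have sS : size S = k by rewrite size_mask ?sE.
have sST : size (S ++ T) = N.+1 by rewrite (perm_size pST).
have ksT : (k + size T)%N = N.+1 by move: sST; rewrite size_cat sS.
have ltT (i : 'I_N.+1) : (k <= i)%N -> (i - k < size T)%N.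
  by move=> ki; rewrite -(ltn_add2l k) ksT subnKC.
have uST : uniq (S ++ T) by rewrite (perm_uniq pST) enum_uniq.
have f_inj : injective (fun i : 'I_N.+1 => nth ord0 (S ++ T) i).
  move=> i j /eqP; rewrite nth_uniq ?sST // => /eqP.
  exact: val_inj.
pose s : 'S_N.+1 := perm f_inj.
have srtS : sorted lt_ord S by apply/sorted_mask/sorted_enum_ord.
have srtT : sorted lt_ord T by apply/sorted_mask/sorted_enum_ord.
exists s.
  rewrite inE; apply/forallP => a; apply/forallP => b; apply/implyP.
  case/andP=> ab abk; rewrite !permE !nth_cat sS.
  case/orP: abk => [bk|ka].
    rewrite bk (ltn_trans ab bk).
    by apply: (sorted_ltn_nth lt_ord_trans ord0 srtS);
      rewrite ?inE ?sS // (ltn_trans ab bk).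
  have kb : (k <= b)%N := leq_trans ka (ltnW ab).
  rewrite [(a < k)%N]ltnNge [(b < k)%N]ltnNge ka kb /=.
  by apply: (sorted_ltn_nth lt_ord_trans ord0 srtT);
    rewrite ?inE ?ltT // ltn_sub2r // (leq_ltn_trans ka).
apply: (@eq_from_nth _ false); rewrite size_shuffle_mask ?sm // => i ltiN.
pose u : 'I_N.+1 := Ordinal ltiN.
rewrite (nth_map ord0) ?sE // -[i in nth ord0 _ i]/(nat_of_ord u) nth_ord_enum.
have -> : nth false m i = (u \in S).
  by rewrite in_mask ?enum_uniq // mem_enum index_enum_ord.
have uST' : u \in S ++ T by rewrite (perm_mem pST) mem_enum.
have -> : u = s (s^-1%g u) :> 'I_N.+1 by rewrite permKV.
set a := s^-1%g u; rewrite permK permE.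
rewrite nth_cat sS; case: ltnP => ak; first by rewrite mem_nth ?sS.
apply/esym/negP => aS; move: uST;
  rewrite cat_uniq => /and3P[_ /hasPn/(_ (nth ord0 T (a - k)))].
rewrite aS => /(_ _)/negP []//.
by rewrite mem_nth // ltT.
Qed.

(** Sums over shuffles are sums over masks. *)
Lemma big_shuffles (W : nmodType) k (F : 'S_N.+1 -> W) (H : bitseq -> W) :
  (k <= N.+1)%N ->
  (forall s, s \in shuffles N.+1 k -> F s = H (shuffle_mask k s)) ->
  \sum_(s in shuffles N.+1 k) F s =
  \sum_(m <- masks N.+1 | count id m == k) H m.
Proof.
move=> lek FH; rewrite -big_enum.
transitivity (\sum_(m <- map (shuffle_mask k) (enum (shuffles N.+1 k))) H m).
  by rewrite big_map; apply: eq_big_seq => s; rewrite mem_enum; apply: FH.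
move: (masks N.+1) (uniq_masks N.+1) (mem_masks N.+1) => M uM memM.
rewrite -[RHS]big_filter; apply: perm_big; apply: uniq_perm.
- rewrite map_inj_in_uniq ?enum_uniq // => s s'; rewrite !mem_enum.
  exact: shuffle_mask_inj.
- exact: filter_uniq.
move=> m; rewrite mem_filter memM; apply/mapP/andP => [[s]|[/eqP cm /eqP sm]].
  rewrite mem_enum => shs ->.
  by rewrite (count_shuffle_mask lek shs) size_shuffle_mask !eqxx.
by have [s shs <-] := shuffle_mask_surj sm cm; exists s; rewrite ?mem_enum.
Qed.

End Shuffles.

(** * Counting inputs from A *)

Section Weight.
Variables (K : fieldType) (charK0 : [pchar K] =i pred0) (A B : lmodType K).
Let V : lmodType K := (A * B)%type.
Local Notation R := (endo (mseq V)).
Implicit Types (S T : R) (F : mseq V) (s : seq V) (t : seq (A + B)).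

Fact proj_fst_subproof : multilinear (fun v : 'I_1 -> V => ((v ord0).1, 0) : V).
Proof. by move=> v i a x y; rewrite ord1 /update eqxx pairDZ1. Qed.
(** The projection onto A as an element of degree 0. *)
Definition proj_fst : multilin V V 1 := Multilin proj_fst_subproof.

(** The derivation whose eigenvalue on a map counts its inputs from A, minus
    one if the output is in A. *)
Definition weight T : R := T * iop proj_fst - iop proj_fst * T.

Lemma weight_lin k S T : weight (k *: S + T) = k *: weight S + weight T.
Proof.
rewrite /weight mulrDl mulrDr -endo_scalerAl -endo_scalerAr scalerBr.
by rewrite opprD addrACA.
Qed.

Lemma weightM S T : weight (S * T) = weight S * T + S * weight T.
Proof. by rewrite /weight mulrBl mulrBr !mulrA [RHS]addrC addrA subrK. Qed.

Lemma weight_gcomm m n (k l : K) S T :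
  weight S = k *: S -> weight T = l *: T ->
  weight (gcomm m n S T) = (k + l) *: gcomm m n S T.
Proof.
move=> wS wT; rewrite /gcomm addrC -scaleNr weight_lin !weightM wS wT.
rewrite -!endo_scalerAl -!endo_scalerAr -!scalerDl.
by rewrite scalerDr (addrC l) !scalerA [in RHS]mulrC.
Qed.

(** The weight of a map in terms of its values: the sum over the inputs of the
    values with this input projected to A, minus the projection of the value. *)
Lemma weight_iop p (f g : multilin V V p.+1) :
  (forall s, (p < size s)%N ->
     \sum_(i < p.+1) on_list f (take i s ++ ((nth 0 s i).1, 0) :: drop i.+1 s) -
     ((on_list f s).1, 0) = on_list g s) ->
  weight (iop f) = iop g.
Proof.
move=> fg; have -> : weight (iop f) = iop (bracket f proj_fst).
  by rewrite iop_bracket muln0 scale1r.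
apply: iop_eq => [|s]; first exact: addn0.
move=> ps0; have ps : (p < size s)%N by rewrite -[p]addn0.
rewrite -fg // bracketE.
have -> (h k : multilin V V (p + 0).+1) : on_list (h - (-1) ^+ (p * 0) *: k) s =
    on_list h s - on_list k s by rewrite muln0 scale1r.
rewrite !on_list_diamond ?addn0 // big_ord1 scale1r drop0 take0; congr (_ - _).
apply: eq_bigr => i _; rewrite muln0 scale1r addn1;
  congr (on_list f (_ ++ _ :: _)).
by rewrite /on_list /= nth_drop addn0.
Qed.

Lemma weight_extend p (f : multilin B A p.+1) :
  weight (iop (extend f)) = - iop (extend f).
Proof.
rewrite -scaleN1r -iopZ scaleN1r.
apply: weight_iop => s ps.
rewrite big1 ?sub0r // => i _; rewrite /on_list /=.
rewrite (multilin0 _ (i := i)) // nth_cat size_takel ?ltnn ?subnn //.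
by rewrite ltnW // (leq_trans (ltn_ord i)).
Qed.

(** Maps from B to A commute, as the output of one is never an input of the
    other. *)
Lemma extend_gcommutes p q (f : multilin B A p.+1) (g : multilin B A q.+1) :
  gcommutes (p, iop (extend f)) (q, iop (extend g)).
Proof.
have dia0 m n N (e : N = (m + n)%N) (h : multilin B A m.+1)
  (k : multilin B A n.+1) :
    diamond_mul e (extend h) (extend k) = 0.
  apply: multilin_ext => v; apply: big1 => i _ /=.
  by rewrite (multilin0 _ (i := i)) ?scaler0 //= ltnn eqxx.
have := iop_bracket (extend f) (extend g).
rewrite bracketE !dia0 scaler0 subr0 iop0 => /esym/eqP.
by rewrite subr_eq0 => /eqP.
Qed.

(* Lists of vectors that lie in one of the two summands. *)
Let inj (x : A + B) : V := match x with inl a => (a, 0) | inr b => (0, b) end.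
Let isA (x : A + B) := if x is inl _ then true else false.

(** A multilinear family is determined by its values on such lists. *)
Lemma mseq_pure F : (forall t, F (map inj t) = 0) -> F = 0.
Proof.
move=> F0; apply: mseq_ext => s.
suff E t : F (map inj t ++ s) = 0 by apply: (E [::]).
elim: s t => [|[a b] s IH] t; first by rewrite cats0 F0.
have -> : (a, b) = inj (inl a) + inj (inr b) :> V.
  by congr pair; rewrite /= ?addr0 ?add0r.
by rewrite mseq_entryD -!cat_rcons -!map_rcons !IH addr0.
Qed.

(** Insertion of the projection counts the inputs from A. *)
Lemma iop_proj_fst F t :
  iop proj_fst F (map inj t) = (count isA t)%:R *: F (map inj t).
Proof.
elim: t F => [|x t IH] F; first by rewrite scale0r.
rewrite [map _ _]/= iop_cons IH drop0 scale1r mseq_consE.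
have -> : on_list proj_fst (inj x :: map inj t) = if isA x then inj x else 0.
  by case: x.
case: x => [a|b] /=; last by rewrite (mseq_entry0 F [::]) add0r.
by rewrite -natr1 scalerDl scale1r addrC.
Qed.

(** The part of a multilinear map that goes from B to A. *)
Fact restrict_subproof p (g : multilin V V p) :
  multilinear (fun v : 'I_p -> B => (g (fun i => (0, v i))).1).
Proof.
move=> v i a x y.
have E z : (fun j => (0, update v i z j) : V) = update (fun j => (0, v j)) i
  (0, z).
  by apply/funext => j; rewrite /update; case: ifP.
rewrite !E -[_ + _ in RHS]/((_ *: _ + _).1) -mfunP; congr (_ (update _ _ _)).1.
by congr pair; rewrite /= scaler0 addr0.
Qed.
Definition restrict p (g : multilin V V p) : multilin B A p :=
  Multilin (restrict_subproof g).

Lemma natr_eq0_char n : (n%:R == 0 :> K) = (n == 0)%N.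
Proof. by move/pcharf0P: charK0; apply. Qed.

(** Weight -1 characterizes the maps from B to A, extended by zero. *)
Lemma extend_restrict p (g : multilin V V p.+1) :
  weight (iop g) = - iop g -> extend (restrict g) = g.
Proof.
move=> wg; apply: iop_id_inj; apply/eqP; rewrite -subr_eq0; apply/eqP.
set F := iop g mseq_id.
have wF t : (count isA t)%:R *: F (map inj t) - ((F (map inj t)).1, 0) =
    - F (map inj t).
  have := congr1 (fun T : R => T mseq_id (map inj t)) wg.
  rewrite /weight endoD !endoN !mseqD !mseqN !endoM iop_proj_fst -/F => <-.
  congr (_ - _).
  pose L (v : V) : V := (v.1, 0).
  have linL : linear L by move=> k u v; exact: pairDZ1.
  transitivity (L (insert g mseq_id (map inj t))); first by [].
  rewrite -insert_comp //; congr (insert g _ _).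
  by apply/funext => -[|v [|w s]]; rewrite iop_id.
apply: mseq_pure => t; rewrite mseqD mseqN iop_id; move: (wF t).
rewrite /F iop_id size_map; case: eqP => [st|_ _]; last by rewrite subrr.
set y := on_list g _; set c := count isA t => wy.
have y2 : y.2 = 0.
  have /eqP := congr1 snd wy; rewrite /= subr0 -subr_eq0 opprK.
  rewrite -{2}[y.2]scale1r -scalerDl natr1 scaler_eq0 natr_eq0_char.
  by move/eqP.
have y1 : c%:R *: y.1 = 0.
  by have /eqP := congr1 fst wy; rewrite /= subr_eq addNr => /eqP.
apply/eqP; rewrite subr_eq0; apply/eqP; rewrite /on_list /=.
have [c0|] := posnP c.
  have t1 i : (nth 0 (map inj t) i).1 = 0.
    have [it|ti] := ltnP i (size t); last by rewrite nth_default // size_map.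
    rewrite (nth_map (inr 0)) //; case E : (nth _ t i) => [a|b] //.
    have /hasPn/(_ (inl a)) : ~~ has isA t by rewrite has_count -/c c0.
    by rewrite -E mem_nth // E => /(_ isT).
  rewrite [RHS]surjective_pairing y2 /y /on_list; congr ((g _).1, 0).
  by apply/funext => i; rewrite [RHS]surjective_pairing t1.
move=> cpos; move: (cpos); rewrite -has_count => /(has_nthP (inr 0))[i];
  rewrite st => ip.
case E : (nth _ t i) => [a|b] // _.
rewrite (multilin0 _ (i := Ordinal ip));
  last by rewrite (nth_map (inr 0)) ?st // E.
rewrite [RHS]surjective_pairing y2; congr pair; apply/esym/eqP.
have /eqP := y1; rewrite scaler_eq0 natr_eq0_char => /orP[/eqP c0|//].
by rewrite c0 in cpos.
Qed.

End Weight.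

(** * The structure operators of a quasi-twilled algebra *)

Section StructureOperators.
Variables (K : fieldType) (charK0 : [pchar K] =i pred0) (A B : lmodType K).
Variable Q : quasi_twilled A B.
Let V : lmodType K := (A * B)%type.
Local Notation R := (endo (mseq V)).

(** The part of the multiplication that enters the [k]-ary operation; it has
    weight [k - 1]. *)
Definition Delta k : R :=
  match k with
  | 1 => iop (nu_harp Q)
  | 2 => iop (mu_tri Q)
  | 3 => iop (theta_tilde Q)
  | _ => 0
  end.

Lemma on_list_binary (m : V -> V -> V) (ml : forall z, linear (m ^~ z))
    (mr : forall z, linear (m z)) u v s :
  on_list (multilin_of_binary ml mr) (u :: v :: s) = m u v.
Proof. by []. Qed.

Lemma weight_binary (c : K) (m : V -> V -> V) (ml : forall z, linear (m ^~ z))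
    (mr : forall z, linear (m z)) :
  (forall u v : V, m (u.1, 0) v + m u (v.1, 0) - ((m u v).1, 0) = c *: m u v) ->
  weight (iop (multilin_of_binary ml mr)) = c *: iop (multilin_of_binary ml mr).
Proof.
move=> mc; rewrite -iopZ.
apply: weight_iop => -[|u [|v s]] // _.
by rewrite !big_ord_recl big_ord0 addr0 /= ?drop0 -mc.
Qed.

Let qt0l (v : V) : qt_mul Q 0 v = 0. Proof. exact: linear0l. Qed.
Let qt0r (v : V) : qt_mul Q v 0 = 0. Proof. exact: linear0r. Qed.
Let pair00 : (0, 0) = 0 :> V. Proof. by []. Qed.

Lemma weight_Delta k : weight (Delta k) = (k%:R - 1) *: Delta k.
Proof.
case: k => [|[|[|[|k]]]]; rewrite /Delta; try
  by rewrite /weight mul0r mulr0 subr0 scaler0.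
- apply: weight_binary => u v.
  rewrite /nu_fun /lharp /rharp /mulB /= !pair00 !(qt0l, qt0r) /= addr0 add0r.
  rewrite subrr scale0r; apply/eqP; rewrite subr_eq0; apply/eqP.
  by congr pair; rewrite /= addr0.
- apply: weight_binary => u v.
  rewrite /mu_fun /rtri /ltri /= !pair00 !(qt0l, qt0r) /= addr0 add0r.
  rewrite (_ : 2%:R - 1 = 1) ?scale1r; last by rewrite -natr1 addrK.
  by congr pair; rewrite /= ?addrK ?subr0.
apply: weight_binary => u v.
rewrite /theta_fun /= pair00 subr0 (_ : 3%:R - 1 = 2%:R);
  last by rewrite -natr1 addrK.
by rewrite scaler_nat mulr2n.
Qed.

(** Associativity of the whole multiplication. *)
Lemma total_sqr0 : (\sum_(i < 4) Delta i) * (\sum_(i < 4) Delta i) = 0.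
Proof.
have [f fE ->] : exists2 f : multilin V V 2,
    forall u v s, on_list f (u :: v :: s) = qt_mul Q u v &
    \sum_(i < 4) Delta i = iop f.
  exists (nu_harp Q + (mu_tri Q + theta_tilde Q)); last first.
    by rewrite !big_ord_recl big_ord0 /= add0r addr0 !iopD.
  move=> [a x] [b y] s; rewrite qt_mulE /on_list /=.
  rewrite /nu_fun /mu_fun /theta_fun /=; congr pair; rewrite /=.
    by rewrite addr0 addrC addrA.
  by rewrite !addrA.
have f0 : iop (diamond_mul (erefl 2) f f) = 0.
  rewrite -(iop0 V 2); apply: iop_eq => // -[|u [|v [|w s]]] // _.
  rewrite on_list_diamond // !big_ord_recl big_ord0 /= !fE qt_assoc.
  by rewrite mul0n scale1r addr0 expr1 scaleN1r subrr.
have := iop_bracket f f; rewrite bracketE.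
have -> : diamond_mul (addnC 1 1) f f = diamond_mul (erefl 2) f f.
  exact: multilin_ext.
rewrite (_ : (-1) ^+ (1 * 1) = -1 :> K) // !scaleN1r !opprK iopD f0 addr0
  => /esym/eqP.
rewrite -mulr2n -scaler_nat scaler_eq0 (natr_eq0_char charK0) /=.
by move/eqP.
Qed.

(** Eigenvectors with distinct eigenvalues 0, .., n - 1 are independent. *)
Lemma eigen_free (W : lmodType K) (phi : W -> W) (y : nat -> W) n :
  linear phi -> (forall k, phi (y k) = k%:R *: y k) ->
  \sum_(k < n) y k = 0 -> forall k, (k < n)%N -> y k = 0.
Proof.
move=> linphi; have phi0 : phi 0 = 0.
  by have := linphi (-1) 0 0; rewrite !scaleN1r !addNr.
have phiZ c z : phi (c *: z) = c *: phi z.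
  by have := linphi c z 0; rewrite phi0 !addr0.
have phiS m (z : nat -> W) : phi (\sum_(k < m) z k) = \sum_(k < m) phi (z k).
  apply: (big_morph phi) => // z1 z2.
  by have := linphi 1 z1 z2; rewrite !scale1r.
elim: n y => // n IH y phiy sum0 k.
(* apply phi - n to the sum to get rid of the last term *)
have yn m : (m < n)%N -> y m = 0.
  move=> mn; have := IH (fun k => (k%:R - n%:R) *: y k).
  have /[swap]/[apply] : forall k, phi ((k%:R - n%:R) *: y k) = k%:R *:
    ((k%:R - n%:R) *: y k).
    by move=> l; rewrite phiZ phiy !scalerA mulrC.
  have -> : \sum_(k < n) (k%:R - n%:R) *: y k = 0.
    have := congr1 (fun z => phi z - n%:R *: z) sum0.
    rewrite phiS phi0 scaler0 subr0 scaler_sumr -sumrB big_ord_recr /=.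
    rewrite phiy subrr addr0 => s0; rewrite -[RHS]s0; apply: eq_bigr => l _.
    by rewrite phiy scalerBl.
  move=> /(_ erefl m mn)/eqP; rewrite scaler_eq0 subr_eq0 => /orP[|/eqP//].
  by rewrite -subr_eq0 -opprB oppr_eq0 -natrB ?(ltnW mn) //
    (natr_eq0_char charK0)
    subn_eq0 leqNgt mn.
rewrite ltnS leq_eqVlt => /orP[/eqP->|/yn//].
move: sum0; rewrite big_ord_recr /= big1 ?add0r // => l _; exact: yn.
Qed.

(** The weight components of the associativity of the multiplication. *)
Lemma Delta_sqr0 n : \sum_(i < n.+1) Delta i * Delta (n - i) = 0.
Proof.
pose y k := \sum_(i < k.+1) Delta i * Delta (k - i).
have D4 k : (4 <= k)%N -> Delta k = 0 by case: k => [|[|[|[|k]]]].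
rewrite -/(y n); have [n7|n7] := ltnP n 7; last first.
  apply: big1 => i _; have [i4|/D4->] := ltnP i 4; last by rewrite mul0r.
  by rewrite [Delta (n - i)]D4 ?mulr0 //; exact: leq_sub n7 (i4 : (i <= 3)%N).
(* y k has weight k - 2; the shift by 2 makes all eigenvalues natural numbers *)
apply: (@eigen_free _ (fun T => 2%:R *: T + weight T) y 7) => //.
- by move=> c S T; rewrite weight_lin !scalerDr !scalerA (mulrC c) addrACA.
- move=> k; have weightD (S T : R) : weight (S + T) = weight S + weight T.
    by rewrite -[S]scale1r weight_lin !scale1r.
  have weight0 : weight 0 = 0 :> R by rewrite /weight mul0r mulr0 subrr.
  rewrite /y (big_morph _ weightD weight0) !scaler_sumr -big_split;
    apply: eq_bigr => i _ /=.
  rewrite weightM !weight_Delta -endo_scalerAl -endo_scalerAr -!scalerDl.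
  congr (_ *: _); rewrite [X in _ + X]addrACA -opprD [LHS]addrC subrK -natrD
    subnKC //.
  by rewrite -ltnS.
transitivity ((\sum_(i < 4) Delta i) * (\sum_(i < 4) Delta i));
  last exact: total_sqr0.
rewrite /y !big_ord_recl !big_ord0 /= !(mul0r, mulr0, add0r, addr0).
rewrite !(mulrDl, mulrDr) !addrA.
by rewrite [RHS](ACl (1*2*4*3*5*7*6*8*9)).
Qed.

End StructureOperators.

(** * The operations on maps from B to A *)

Section Operations.
Variables (K : fieldType) (charK0 : [pchar K] =i pred0) (A B : lmodType K).
Variable Q : quasi_twilled A B.
Let V : lmodType K := (A * B)%type.
Local Notation R := (endo (mseq V)).
Local Notation G := (bspace A B).

(** The operator of a map from B to A, extended by zero. *)
Definition bop n (f : bcomp A B n) : R := iop (extend f).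

Lemma bop_lin n k (f g : bcomp A B n) : bop (k *: f + g) = k *: bop f + bop g.
Proof.
rewrite -iop_lin; congr iop; apply: multilin_ext => v.
by congr pair; rewrite /= scaler0 addr0.
Qed.

Lemma bop0 n : bop (0 : bcomp A B n) = 0.
Proof. by have := bop_lin (-1) (0 : bcomp A B n) 0;
  rewrite !scaleN1r !addNr. Qed.

(** The component of [F] with [n] inputs. *)
Fact mseq_arity_subproof n (F : mseq V) :
  multilinear (fun v : 'I_n -> V => F [seq v i | i <- enum 'I_n]).
Proof.
move=> v i a x y.
have E z : [seq update v i z j | j <- enum 'I_n] =
    [seq v j | j <- take i (enum 'I_n)] ++ z :: [seq v j | j <- drop i.+1
      (enum 'I_n)].
  have ltin : (i < size (enum 'I_n))%N by rewrite size_enum_ord.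
  have := enum_uniq 'I_n; rewrite -{1 2}(cat_take_drop i (enum 'I_n))
    (drop_nth i ltin).
  rewrite nth_ord_enum cat_uniq => /and3P[_ /norP[it _] /andP[id _]].
  rewrite map_cat /= {2}/update eqxx; congr (_ ++ _ :: _);
    apply/eq_in_map => j jE.
    by rewrite /update; case: eqP jE => // ->; rewrite (negPf it).
  by rewrite /update; case: eqP jE => // ->; rewrite (negPf id).
rewrite !E; exact: mseqP.
Qed.
Definition mseq_arity n F : multilin V V n :=
  Multilin (@mseq_arity_subproof n F).

(** The component in [Hom(B^(m+1), A)] of an operator. *)
Definition bcoord m (T : R) : bcomp A B m :=
  restrict (mseq_arity m.+1 (T mseq_id)).

Lemma bcoord_lin m k S T : bcoord m (k *: S + T) = k *: bcoord m S + bcoord m T.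
Proof. exact: multilin_ext. Qed.

Lemma bcoordD m S T : bcoord m (S + T) = bcoord m S + bcoord m T.
Proof. exact: multilin_ext. Qed.

Lemma bcoordZ m k S : bcoord m (k *: S) = k *: bcoord m S.
Proof. exact: multilin_ext. Qed.

Lemma bcoord0 m : bcoord m 0 = 0.
Proof. exact: multilin_ext. Qed.

Lemma bcoord_iop m (g : multilin V V m.+1) : bcoord m (iop g) = restrict g.
Proof.
apply: multilin_ext => v; pose w i : V := (0, v i).
transitivity (iop g mseq_id [seq w i | i <- enum 'I_m.+1]).1; first by [].
by rewrite iop_id size_map size_enum_ord eqxx on_list_enum.
Qed.

Lemma bcoord_bop m (f : bcomp A B m) : bcoord m (bop f) = f.
Proof. by rewrite bcoord_iop; apply: multilin_ext. Qed.

Section EntryLinearity.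
Variables (k : nat) (n : 'I_k -> nat).

Lemma ibr_lin_entry b T (x : 'I_k -> G) i a y z (r : seq 'I_k) :
  uniq r -> i \in r ->
  let X w := [seq (n j, bop (update x i w j (n j))) | j <- r] in
  ibr b T (X (a *: y + z)) = a *: ibr b T (X y) + ibr b T (X z).
Proof.
elim: r b T => // j r IH b T /= /andP[jr ur];
  rewrite in_cons => /orP[/eqP ij|ir].
  subst j; have E w : [seq (n j, bop (update x i w j (n j))) | j <- r] =
      [seq (n j, bop (x j (n j))) | j <- r].
    by apply/eq_in_map => j jr'; rewrite /update; case: eqP jr' jr => // -> ->.
  have Ei w : update x i w i = w by rewrite /update eqxx.
  rewrite !E !Ei -[(a *: y + z) (n i)]/(a *: y (n i) + z (n i)).
  by rewrite bop_lin gcomm_linr ibr_lin.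
have ji w : update x i w j = x j.
  by rewrite /update; case: eqP ir jr => // -> ->.
by rewrite !ji IH.
Qed.

Lemma ibr_zero_entry b T (X : 'I_k -> R) i : X i = 0 ->
  ibr b T [seq (n j, X j) | j <- enum 'I_k] = 0.
Proof.
move=> Xi; have := mem_enum 'I_k i; case/splitPr => r1 r2.
by rewrite map_cat /= Xi ibr_entry0.
Qed.

End EntryLinearity.

(** The component of degree [m] of the [k]-ary operation: the sum of the
    iterated commutators over all choices [d] of the degrees of the components
    of the arguments that contribute to it. *)
Definition lop_coord k (x : 'I_k -> G) m : bcomp A B m :=
  \sum_(d : {ffun 'I_k -> 'I_m})
    if ((\sum_i d i).+1 == m)%N then
      bcoord m (ibr 1 (Delta Q k)
        [seq (nat_of_ord (d i), bop (x i (d i))) | i <- enum 'I_k])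
    else 0.

Fact lop_finite k (x : 'I_k -> G) :
  exists N, forall m, (N <= m)%N -> lop_coord x m = 0.
Proof.
have /fin_all_exists[N xN] i := coord_fin (x i).
exists (\sum_i N i).+2 => m Nm; apply: big1 => d _; case: eqP => // dm.
have [i Ni] : exists i, (N i <= d i)%N.
  apply/existsP; apply: contraTT Nm; rewrite negb_exists => /forallP dN.
  rewrite -ltnNge -dm !ltnS; apply: leq_sum => i _.
  by rewrite ltnW // ltnNge.
by rewrite (ibr_zero_entry _ _ _ (i := i)) ?bcoord0 // xN ?bop0.
Qed.

Fact lop_multilinear k :
  multilinear (fun x : 'I_k -> G => DSum (lop_finite x) : G).
Proof.
move=> x i a y z; apply: dsum_ext => m /=.
rewrite scaler_sumr -big_split; apply: eq_bigr => d _ /=.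
case: eqP => _; last by rewrite scaler0 addr0.
rewrite -bcoord_lin; congr bcoord.
by rewrite -(ibr_lin_entry (fun j => nat_of_ord (d j))) ?enum_uniq ?mem_enum.
Qed.

(** The [k]-ary operation of the L-infinity algebra, for all [k]. *)
Definition lop k : multilin G G k := Multilin (@lop_multilinear k).

(** On homogeneous arguments a single choice of degrees contributes. *)
Lemma lop_homog k (x : 'I_k -> G) (n : 'I_k -> nat) m :
  (forall i j, j != n i -> x i j = 0) ->
  lop k x m =
  if ((\sum_i n i).+1 == m)%N then
    bcoord m (ibr 1 (Delta Q k) [seq (n i, bop (x i (n i))) | i <- enum 'I_k])
  else 0.
Proof.
move=> xn; rewrite /= /lop_coord.
have off (d : {ffun 'I_k -> 'I_m}) i : nat_of_ord (d i) != n i ->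
    (if ((\sum_i d i).+1 == m)%N then
      bcoord m (ibr 1 (Delta Q k)
        [seq (nat_of_ord (d i), bop (x i (d i))) | i <- enum 'I_k])
    else 0) = 0.
  move=> di; case: eqP => // _.
  by rewrite (ibr_zero_entry _ _ _ (i := i)) ?bcoord0 // xn // bop0.
case: eqP => nm; last first.
  apply: big1 => d _; have [i di|dn] := pickP (fun i => nat_of_ord (d i) != n
    i).
    exact: off di.
  case: eqP => // dm; case: nm; rewrite -dm; congr _.+1.
  by apply: eq_bigr => i _; move/negbFE/eqP: (dn i).
have ltn i : (n i < m)%N by rewrite -nm ltnS (bigD1 i) //= leq_addr.
rewrite (bigD1 [ffun i => Ordinal (ltn i)]) //= [X in _ + X]big1 ?addr0.
  have E : \sum_i nat_of_ord ([ffun i => Ordinal (ltn i)] i) = \sum_i n i :>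
    nat.
    by apply: eq_bigr => i _; rewrite ffunE.
  rewrite E nm eqxx; congr (bcoord m (ibr _ _ _)).
  by apply: eq_map => i; rewrite ffunE.
move=> d dn; have [i di|dE] := pickP (fun i => nat_of_ord (d i) != n i);
  first exact: off di.
case/eqP: dn; apply/ffunP => i; apply: val_inj; rewrite ffunE /=.
by move/negbFE/eqP: (dE i).
Qed.

(** Homogeneous operators that come from maps from B to A. *)
Definition from_b (y : nat * R) : Prop := exists f : bcomp A B y.1, y.2 = bop f.

Lemma from_b_comm x y : from_b x -> from_b y -> gcommutes x y.
Proof. by case: x y => [p X] [q Y] [f /= ->] [g /= ->];
  apply: extend_gcommutes. Qed.

Lemma ibr_iop (xs : seq (nat * R)) b (g : multilin V V b.+1) :
  (forall x, x \in xs -> from_b x) ->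
  exists h : multilin V V (b + degs xs).+1, ibr b (iop g) xs = iop h.
Proof.
elim: xs b g => [|[n X] xs IH] b g xsb.
  by rewrite /degs /= addn0; exists g.
have [f /= ->] : from_b (n, X) by apply: xsb; rewrite mem_head.
rewrite [ibr _ _ _]/= /bop /gcomm -iop_bracket -[degs _]/(n + degs xs)%N addnA.
apply: IH => y yxs.
by apply: xsb; rewrite in_cons yxs orbT.
Qed.

Lemma Delta_iop k : exists g : multilin V V 2, Delta Q k = iop g.
Proof.
by case: k => [|[|[|[|k]]]] /=; try (by eexists); exists 0; rewrite iop0.
Qed.

Lemma weight_ibr (xs : seq (nat * R)) b T (c : K) :
  (forall x, x \in xs -> from_b x) -> weight T = c *: T ->
  weight (ibr b T xs) = (c - (size xs)%:R) *: ibr b T xs.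
Proof.
elim: xs b T c => [|[n X] xs IH] b T c xsb wT; first by rewrite subr0.
have [f /= ->] : from_b (n, X) by apply: xsb; rewrite mem_head.
rewrite (IH _ _ (c - 1)); first by rewrite -natr1 opprD addrA addrAC.
  by move=> y yxs; apply: xsb; rewrite in_cons yxs orbT.
by apply: weight_gcomm; rewrite // weight_extend scaleN1r.
Qed.

(** [k]-fold commutators of [Delta k] with maps from B to A have weight -1. *)
Lemma weight_Delta_ibr (xs : seq (nat * R)) k :
  (forall x, x \in xs -> from_b x) -> size xs = k ->
  weight (ibr 1 (Delta Q k) xs) = - ibr 1 (Delta Q k) xs.
Proof.
move=> xsb <-; rewrite (weight_ibr 1 xsb (weight_Delta Q (size xs))).
by rewrite addrC addrA addNr sub0r scaleN1r.
Qed.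

Lemma from_b_closed k (xs : seq (nat * R)) :
  (forall x, x \in xs -> from_b x) -> size xs = k ->
  from_b ((1 + degs xs)%N, ibr 1 (Delta Q k) xs).
Proof.
move=> xsb xsk; have := weight_Delta_ibr xsb xsk.
have [g ->] := Delta_iop k; have [h ->] := ibr_iop g xsb => wh.
by exists (restrict h); rewrite /bop extend_restrict.
Qed.

Lemma bop_bcoord m T : from_b (m, T) -> bop (bcoord m T) = T.
Proof. by case=> f /= ->; rewrite bcoord_bop. Qed.

End Operations.

(** * The L-infinity structure *)

Section DirectSumGrading.
Variables (K : fieldType) (G : nat -> lmodType K).
Implicit Types x y : dsum G.

Lemma coord_sum (I : Type) (r : seq I) (P : pred I) (F : I -> dsum G) n :
  (\sum_(i <- r | P i) F i) n = \sum_(i <- r | P i) F i n.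
Proof. exact: (big_morph (fun x : dsum G => x n)). Qed.

Lemma coordZ (a : K) x n : (a *: x) n = a *: x n.
Proof. by []. Qed.

Lemma dsum_in_out n (a : G n) m : m != n -> dsum_in G n a m = 0.
Proof. by move=> mn; apply: dfwith_out; rewrite eq_sym. Qed.

Lemma dsum_is_grading : is_grading (dsum_grade G).
Proof.
split.
- by [].
- by move=> n a x y xn yn m mn /=; rewrite xn // yn // scaler0 addr0.
- move=> x; have [N xN] := coord_fin x.
  exists (map Posz (iota 0 N)).
  exists (fun k => if k is Posz n then dsum_in G n (x n) else 0); split.
  + by rewrite map_inj_uniq ?iota_uniq // => ? ? [].
  + move=> [n|n] m mn //; exact: dsum_in_out.
  apply: dsum_ext => m; rewrite coord_sum big_map.
  have [mN|Nm] := ltnP m N; last first.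
    rewrite xN // big1_seq // => k /andP[_]; rewrite mem_iota => /andP[_ kN].
    by apply: dsum_in_out; rewrite gtn_eqF // (leq_trans kN).
  rewrite (bigD1_seq m) ?iota_uniq ?mem_iota //= dfwith_in big1 ?addr0 //
    => k km.
  by apply: dsum_in_out; rewrite eq_sym.
move=> s y us yn sum0 n ns; apply: dsum_ext => m.
have [mn|/yn->//] := eqVneq m%:Z n.
have /(congr1 (fun x : dsum G => x m)) := sum0.
rewrite coord_sum (bigD1_seq n) //= big1 ?addr0 // => k kn.
by apply: yn; rewrite mn eq_sym.
Qed.

(** An element of degree [d] has at most one coordinate, of index [|d|]. *)
Lemma dsum_grade_coord (d : int) x : dsum_grade G d x ->
  forall n, n != `|d|%N -> x n = 0.
Proof. by move=> xd n nd; apply: xd; apply: contraNneq nd => <-. Qed.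

End DirectSumGrading.

Section LInfinity.
Variables (K : fieldType) (charK0 : [pchar K] =i pred0) (A B : lmodType K).
Variable Q : quasi_twilled A B.
Let V : lmodType K := (A * B)%type.
Local Notation R := (endo (mseq V)).
Local Notation G := (bspace A B).
Local Notation gr := (dsum_grade (bcomp A B)).
Local Notation lop := (lop Q).

Lemma lop_degree k (d : 'I_k -> int) (x : 'I_k -> G) :
  (forall i, gr (d i) (x i)) -> gr (\sum_i d i + 1) (lop k x).
Proof.
move=> xd m mN; pose n i := `|d i|%N.
have xn i j : j != n i -> x i j = 0 by apply: dsum_grade_coord (xd i) j.
rewrite (lop_homog Q m xn); case: eqP => // nm.
have [i din|dn] := pickP (fun i => (n i)%:Z != d i).
  by rewrite (ibr_zero_entry _ _ _ (i := i)) ?bcoord0 // (xd i _ din) bop0.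
case/eqP: mN; rewrite -nm -[LHS]natz -natr1 natr_sum; congr (_ + _).
by apply: eq_bigr => i _; move/negbFE/eqP: (dn i) => <-; rewrite natz.
Qed.

Lemma from_b_bop n (f : bcomp A B n) : from_b (n, bop f).
Proof. by exists f. Qed.

Lemma lop_symmetric k (d : 'I_k -> int) (x : 'I_k -> G) (s : 'S_k) :
  (forall i, gr (d i) (x i)) ->
  lop k (fun i => x (s i)) = koszul K s d *: lop k x.
Proof.
case: k d x s => [|k] d x s xd.
  rewrite /koszul big_ord0 scale1r; congr (_ _); apply/funext => -[] //.
pose n i := `|d i|%N.
have xn i j : j != n i -> x i j = 0 by apply: dsum_grade_coord (xd i) j.
apply: dsum_ext => m.
rewrite coordZ (lop_homog Q m xn).
rewrite (lop_homog Q (x := fun i => x (s i)) m (fun i j => xn (s i) j)).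
have -> : (\sum_i n (s i) = \sum_i n i)%N by rewrite [RHS](reindex_inj
  (@perm_inj _ s)).
case: eqP => _; last by rewrite scaler0.
rewrite -bcoordZ; congr bcoord.
pose X i := bop (x i (n i)).
rewrite (koszul_sort_sign K s (n := n)) //.
rewrite -(@ibr_sort _ _ n _ X 1 _ _ (enum _)).
- by congr (ibr 1 _ _); rewrite -[RHS]map_comp.
- by move=> i j; apply: from_b_comm; apply: from_b_bop.
- apply: uniq_perm; [|exact: enum_uniq|].
    by rewrite map_inj_uniq ?enum_uniq //; exact: perm_inj.
  move=> i; rewrite mem_enum; apply/mapP; exists (s^-1%g i);
    first by rewrite mem_enum.
  by rewrite permKV.
- exact: sorted_enum_ord.
Qed.

Lemma map_iota k (T : Type) (f : nat -> T) :
  [seq f (nat_of_ord i) | i <- enum 'I_k] = [seq f i | i <- iota 0 k].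
Proof. by rewrite -[in RHS]val_enum_ord -map_comp. Qed.

Lemma sum_iota k (f : nat -> nat) :
  (\sum_(i < k) f i = sumn (map f (iota 0 k)))%N.
Proof. by rewrite sumnE big_map -[k in iota 0 k]subn0 big_mkord. Qed.

Lemma degs_mask_negb m (xs : seq (nat * R)) : size m = size xs ->
  (degs (mask m xs) + degs (mask (map negb m) xs) = degs xs)%N.
Proof.
move=> smx; rewrite /degs -sumn_cat -map_cat; apply: perm_sumn; apply: perm_map.
exact: perm_mask_negb.
Qed.

(** The higher Jacobi identity, checked componentwise.  Only the component whose
    degree is the total degree of the arguments plus two can be nonzero. *)
Lemma lop_jacobi N (d : 'I_N.+1 -> int) (x : 'I_N.+1 -> G) :
  (forall i, gr (d i) (x i)) ->
  \sum_(1 <= i < N.+2) \sum_(s in shuffles N.+1 i)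
    koszul K s d *:
      lop (N.+1 - i).+1 (fun j =>
        if j == ord0 then lop i (fun t => x (s (inord t)))
        else x (s (inord (i + j).-1))) = 0.
Proof.
move=> xd; apply: dsum_ext => M.
pose n i := `|d i|%N.
have xn i j : j != n i -> x i j = 0 by apply: dsum_grade_coord (xd i) j.
pose it i : nat * R := (n i, bop (x i (n i))).
pose xs := map it (enum 'I_N.+1).
have sxs : size xs = N.+1 by rewrite size_map size_enum_ord.
pose C m := ibr 1 (Delta Q ((size xs).+1 - count id m))
  (((1 + degs (mask m xs))%N, ibr 1 (Delta Q (count id m)) (mask m xs))
     :: mask (map negb m) xs).
pose c := ((degs xs).+2 == M)%N.
pose H m : bcomp A B M := if c then bcoord M (msign m xs *: C m) else 0.
have xsb y : y \in xs -> from_b y by case/mapP => i _ ->; exact: from_b_bop.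
have step i : (1 <= i < N.+2)%N ->
    (\sum_(s in shuffles N.+1 i) koszul K s d *:
      lop (N.+1 - i).+1 (fun j =>
        if j == ord0 then lop i (fun t => x (s (inord t)))
        else x (s (inord (i + j).-1)))) M =
    \sum_(m <- masks N.+1 | count id m == i) H m.
  case/andP=> i1; rewrite ltnS => iN; rewrite coord_sum;
    apply: big_shuffles => // s shs.
  rewrite coordZ.
  have [S1 S2] := shuffle_maskE iN shs.
  set m := shuffle_mask i s in S1 S2 *.
  have cm : count id m = i by apply: count_shuffle_mask.
  have sm : size m = size xs by rewrite size_shuffle_mask sxs.
  pose n0 := (1 + degs (mask m xs))%N.
  have L1 : [seq it (s (inord t)) | t <- iota 0 i] = mask m xs.
    by rewrite -map_mask -S1 -map_comp.
  have L2 : [seq it (s (inord t)) | t <- iota i (N.+1 - i)] =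
      mask (map negb m) xs.
    by rewrite -map_mask -S2 -map_comp.
  have yE k : lop i (fun t => x (s (inord t))) k =
      if (n0 == k)%N then bcoord k (ibr 1 (Delta Q i) (mask m xs)) else 0.
    rewrite (lop_homog Q k (n := fun t => n (s (inord t)))); last first.
      by move=> t j; apply: xn.
    rewrite (sum_iota i (fun t => n (s (inord t)))) -L1.
    by rewrite -(map_iota i (fun t => it (s (inord t)))) /n0 -L1 /degs
      -map_comp.
  pose y (j : 'I_(N.+1 - i).+1) :=
    if j == ord0 then lop i (fun t => x (s (inord t)))
    else x (s (inord (i + j).-1)).
  pose n' (j : 'I_(N.+1 - i).+1) :=
    if j == ord0 then n0 else n (s (inord (i + j).-1)).
  have yn' j k : k != n' j -> y j k = 0.
    rewrite /y /n'; case: (j == ord0) => [kn0|]; last exact: xn.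
    by rewrite yE eq_sym (negPf kn0).
  pose F (t : nat) : nat * R :=
    if t == 0%N then (n0, ibr 1 (Delta Q i) (mask m xs))
    else it (s (inord (i + t).-1)).
  have Flist : [seq (n' j, bop (y j (n' j))) | j <- enum 'I_(N.+1 - i).+1] =
      (n0, ibr 1 (Delta Q i) (mask m xs)) :: mask (map negb m) xs.
    transitivity [seq F (nat_of_ord j) | j <- enum 'I_(N.+1 - i).+1].
      apply: eq_map => j; rewrite /F /y /n' -[j == ord0]/(nat_of_ord j == 0%N).
      case: eqP => // _; rewrite yE eqxx bop_bcoord //.
      by apply: from_b_closed; rewrite ?size_mask // => z /mem_mask/xsb.
    have iotaE l k : iota l k = map (addn l) (iota 0 k) by rewrite -iotaDl
      addn0.
    rewrite map_iota /= -L2 iotaE (iotaE i) -!map_comp.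
    by congr (_ :: _); apply: eq_map => t; rewrite /F /= addnS.
  rewrite (lop_homog Q M yn') Flist.
  have -> : (\sum_j n' j = (degs xs).+1)%N.
    transitivity (degs [seq (n' j, bop (y j (n' j))) | j <- enum
      'I_(N.+1 - i).+1]).
      by rewrite /degs -map_comp sumnE big_map big_enum.
    by rewrite Flist /degs /= -!/(degs _) -addnA degs_mask_negb.
  rewrite /H -/c; case: ifP => _; last by rewrite scaler0.
  rewrite -bcoordZ; congr bcoord; rewrite /C cm sxs -subSn //.
  congr (_ *: _); rewrite (koszul_sort_sign K s (n := n)) //
    (shuffle_enum iN shs).
  by apply: sort_sign_mask;
    rewrite ?size_shuffle_mask ?size_enum_ord ?sorted_enum_ord.
rewrite coord_sum (eq_big_nat _ _ step).
transitivity (\sum_(m <- masks N.+1) H m).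
  transitivity (\sum_(0 <= i < N.+2) \sum_(m <- masks N.+1 | count id m == i) H
    m).
    (* the empty mask contributes the zero operation in arity 0 *)
    rewrite [RHS]big_ltn // [X in _ = X + _]big1 ?add0r // => m /eqP cm.
    rewrite /H; case: ifP => // _; rewrite /C cm.
    have nilm b (r : seq (nat * R)) : count id b = 0%N -> mask b r = [::].
      by elim: b r => [|[] b IH] [|y r] //= /IH.
    rewrite nilm //.
    by rewrite /= /gcomm mulr0 mul0r scaler0 subr0 ibr0 scaler0 bcoord0.
  under eq_bigr do rewrite big_mkcond.
  rewrite exchange_big; apply: eq_big_seq => m; rewrite mem_masks => /eqP sm /=.
  rewrite -big_mkcond; under eq_bigl do rewrite eq_sym.
  by rewrite big_nat1_eq /= ltnS (leq_trans (count_size _ _)) ?sm.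
have [cT|/negPf cF] := boolP c; last by apply: big1 => m _; rewrite /H cF.
rewrite (eq_bigr (fun m => bcoord M (msign m xs *: C m))); last by move=> m _;
  rewrite /H cT.
rewrite -(big_morph (@bcoord K A B M) (@bcoordD K A B M) (@bcoord0 K A B M))
  -sxs.
have -> : \sum_(m <- masks (size xs)) msign m xs *: C m = 0;
  last exact: bcoord0.
apply: (higher_jacobi (H := @from_b K A B)) => //.
- exact: from_b_comm.
- by move=> k ys; apply: from_b_closed.
exact: Delta_sqr0.
Qed.

End LInfinity.

(** * Explicit formulas and Maurer-Cartan elements *)

Section MaurerCartan.
Variables (K : fieldType) (charK0 : [pchar K] =i pred0) (A B : lmodType K).
Variable Q : quasi_twilled A B.
Let V : lmodType K := (A * B)%type.
Local Notation G := (bspace A B).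
Local Notation gr := (dsum_grade (bcomp A B)).
Local Notation lop := (lop Q).
Local Notation inb := (dsum_in (bcomp A B)).

Lemma lop_Linfty : is_Linfty gr lop.
Proof.
split.
- exact: dsum_is_grading.
- by move=> k d x _; apply: lop_degree.
- by move=> k d x s _; apply: lop_symmetric.
- by move=> N d x; apply: lop_jacobi.
Qed.

(** The operations, extended by zero, are the iterated brackets. *)
Lemma extend_lop k (x : 'I_k -> G) (n : 'I_k -> nat) m (g : multilin V V m.+1) :
  (forall i j, j != n i -> x i j = 0) -> ((\sum_i n i).+1 = m)%N ->
  ibr 1 (Delta Q k) [seq (n i, bop (x i (n i))) | i <- enum 'I_k] = iop g ->
  extend (lop k x m) = g.
Proof.
move=> xn nm gE; rewrite (lop_homog Q m xn) nm eqxx gE bcoord_iop.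
apply: extend_restrict => //; rewrite -gE weight_Delta_ibr //.
- by move=> y /mapP[i _ ->]; exact: from_b_bop.
- by rewrite size_map size_enum_ord.
Qed.

Lemma extend_lop1 p (f : bcomp A B p) :
  extend (lop 1 (fun=> inb p f) (1 + p)) = bracket (nu_harp Q) (extend f).
Proof.
apply: (@extend_lop _ _ (fun=> p)) => [i j|/=|].
- exact: dsum_in_out.
- by rewrite big_ord1.
rewrite (map_iota 1 (fun=> _)) /= dfwith_in.
by rewrite iop_bracket.
Qed.

Lemma extend_lop2 p q (f : bcomp A B p) (g : bcomp A B q) :
  extend (lop 2 (fun i => [:: inb p f; inb q g]`_i) (1 + p + q)) =
  bracket (bracket (mu_tri Q) (extend f)) (extend g).
Proof.
apply: (@extend_lop _ _ (fun i => nth 0%N [:: p; q] i)).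
- by case=> -[|[|//]] ? j; apply: dsum_in_out.
- by rewrite !big_ord_recl big_ord0 /= addn0.
rewrite (map_iota 2 (fun i => (nth 0%N [:: p; q] i,
  bop ([:: inb p f; inb q g]`_i (nth 0%N [:: p; q] i))))) /= !dfwith_in.
by rewrite !iop_bracket.
Qed.

Lemma extend_lop3 p q s (f : bcomp A B p) (g : bcomp A B q) (h : bcomp A B s) :
  extend (lop 3 (fun i => [:: inb p f; inb q g; inb s h]`_i) (1 + p + q + s)) =
  bracket (bracket (bracket (theta_tilde Q) (extend f)) (extend g)) (extend h).
Proof.
apply: (@extend_lop _ _ (fun i => nth 0%N [:: p; q; s] i)).
- by case=> -[|[|[|//]]] ? j; apply: dsum_in_out.
- by rewrite !big_ord_recl big_ord0 /= addn0 addnA.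
rewrite (map_iota 3 (fun i => (nth 0%N [:: p; q; s] i,
  bop ([:: inb p f; inb q g; inb s h]`_i (nth 0%N [:: p; q; s] i))))) /=
    !dfwith_in.
by rewrite !iop_bracket.
Qed.

Lemma lop_ge4 k : (4 <= k)%N -> lop k = 0.
Proof.
move=> k4; apply: multilin_ext => x; apply: dsum_ext => m.
apply: big1 => d _; case: ifP => // _.
by case: k k4 {x d} (map _ _) => [|[|[|[|k]]]] // _ xs; rewrite ibr0 bcoord0.
Qed.

Section Solution.
Variable r : {linear B -> A}.
Let rho : bcomp A B 0 := multilin_of_linear r.
Let alpha : G := inb 0 rho.
Let rr (v : V) : V := (r v.2, 0).

Lemma on_list_bracket_linear (f : multilin V V 2) (v w : V) :
  on_list (bracket f (extend rho)) [:: v; w] =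
  on_list f [:: rr v; w] + on_list f [:: v; rr w] - rr (on_list f [:: v; w]).
Proof.
rewrite bracketE.
have -> (h k : multilin V V (1 + 0).+1) : on_list (h - (-1) ^+ (1 * 0) *: k)
  [:: v; w] =
    on_list h [:: v; w] - on_list k [:: v; w] by rewrite scale1r.
rewrite !on_list_diamond // !big_ord_recl !big_ord0 !addr0.
by rewrite !muln0 mul0n !scale1r.
Qed.

Let rr0 : rr 0 = 0. Proof. by rewrite /rr linear0. Qed.
Let rrD v w : rr (v + w) = rr v + rr w.
Proof. by rewrite /rr linearD; congr pair; rewrite /= addr0. Qed.
Let rrN v : rr (- v) = - rr v.
Proof. by rewrite /rr linearN; congr pair; rewrite /= oppr0. Qed.
Let rrrr v : rr (rr v) = 0. Proof. exact: rr0. Qed.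

Lemma on_list_0l (f : multilin V V 2) w : on_list f [:: 0; w] = 0.
Proof. exact: (multilin0 _ (i := ord0)). Qed.
Lemma on_list_0r (f : multilin V V 2) v : on_list f [:: v; 0] = 0.
Proof. exact: (multilin0 _ (i := ord_max)). Qed.

(** Here r maps B to A and kills A, so its square is zero. *)
Lemma on_list_bracket2 (f : multilin V V 2) (v w : V) :
  on_list (bracket (bracket f (extend rho)) (extend rho)) [:: v; w] =
  (on_list f [:: rr v; rr w] - rr (on_list f [:: rr v; w])
     - rr (on_list f [:: v; rr w])) *+ 2.
Proof.
rewrite (on_list_bracket_linear (bracket f (extend rho)))
  !on_list_bracket_linear.
rewrite !rrrr on_list_0l on_list_0r !rrD !rrN !rrrr oppr0 add0r !addr0.
set X := on_list f [:: rr v; rr w]; set Y := rr _; set Z := rr _.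
by rewrite mulr2n opprD !addrA [LHS](ACl (1*2*4*3*5*6)).
Qed.

Lemma on_list_bracket3 (f : multilin V V 2) (v w : V) :
  on_list (bracket (bracket (bracket f (extend rho)) (extend rho)) (extend rho))
    [:: v; w] = - rr (on_list f [:: rr v; rr w]) *+ 6.
Proof.
rewrite (on_list_bracket_linear (bracket (bracket f (extend rho))
  (extend rho))).
rewrite !on_list_bracket2 !rrrr !on_list_0l !on_list_0r !rr0.
set X := rr _; rewrite !mulr2n !rrD !rrN !rrrr !oppr0 !addr0 !add0r -/X.
by rewrite opprD !mulrS mulr0n addr0 !addrA.
Qed.

(** The left-hand side of the Maurer-Cartan equation is the defect of the
    weak deformation map equation. *)
Lemma maurer_cartan_coord (w : 'I_2 -> B) :
  let x := w ord0 in let y := w ord_max in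
  (\sum_(1 <= k < 4) (k`!%:R : K)^-1 *: lop k (fun=> alpha)) 1%N w =
  Defs.mulA Q (r x) (r y) + lharp Q (r x) y + rharp Q x (r y) -
  r (mulB Q x y + rtri Q (r x) y + ltri Q x (r y) + theta Q (r x) (r y)).
Proof.
move=> x y; rewrite coord_sum 3?big_ltn // big_geq // addr0 !coordZ.
pose u (b : B) : V := (0, b).
have wE : w = (fun i : 'I_2 => (nth 0 [:: u x; u y] i).2).
  by apply/funext => -[[|[|//]] lti]; congr w; apply: val_inj.
have val (h : bcomp A B 1) : h w = (on_list (extend h) [:: u x; u y]).1.
  by rewrite wE.
pose h k : bcomp A B 1 := lop k (fun=> alpha) 1%N.
transitivity ((1`!%:R : K)^-1 *: h 1%N w +
  ((2`!%:R : K)^-1 *: h 2%N w + (3`!%:R : K)^-1 *: h 3%N w)); first by [].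
have h1 : extend (h 1%N) = bracket (nu_harp Q) (extend rho)
  by exact: extend_lop1.
have h2 : extend (h 2%N) = bracket (bracket (mu_tri Q) (extend rho))
  (extend rho).
  rewrite -extend_lop2 /h; congr (extend (lop 2 _ 1)).
  by apply/funext => -[[|[|//]] lti].
have h3 : extend (h 3%N) = bracket
  (bracket (bracket (theta_tilde Q) (extend rho))
    (extend rho)) (extend rho).
  rewrite -extend_lop3 /h; congr (extend (lop 3 _ 1)).
  by apply/funext => -[[|[|[|//]]] lti].
rewrite !val h1 h2 h3 on_list_bracket_linear on_list_bracket2 on_list_bracket3.
rewrite !on_list_binary -!scaler_nat.
have fstZ (c : K) (v : V) : (c *: v).1 = c *: v.1 by [].
have natK n : (n.+1%:R : K)^-1 * n.+1%:R = 1.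
  by rewrite mulVf // (natr_eq0_char charK0).
have c1 : (1`!%:R : K)^-1 = 1 by exact: invr1.
have c2 : (2`!%:R : K)^-1 * 2%:R = 1 by exact: (natK 1).
have c3 : (3`!%:R : K)^-1 * 6%:R = 1 by exact: (natK 5).
rewrite !fstZ !scalerA c1 c2 c3 !scale1r.
have qt0 : qt_mul Q (0, 0) (0, 0) = 0 by exact: linear0l.
have [rh0 lh0 rt0 lt0] : [/\ rharp Q 0 0 = 0, lharp Q 0 0 = 0, rtri Q 0 0 = 0 &
    ltri Q 0 0 = 0] by rewrite /rharp /lharp /rtri /ltri qt0.
rewrite /rr /u /= rh0 lh0 rt0 lt0 !addr0 !add0r.
have rD a b : r (a + b) = r a + r b by exact: linearD.
rewrite !rD !opprD !addrA.
by rewrite [LHS](ACl (4*1*2*3*5*6*7)).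
Qed.

(** Operations of arity greater than 3 vanish, so the Maurer-Cartan sum may be
    cut at 3. *)
Lemma maurer_cartan3 : maurer_cartan gr lop alpha <->
  \sum_(1 <= k < 4) (k`!%:R : K)^-1 *: lop k (fun=> alpha) = 0.
Proof.
pose F k := (k`!%:R : K)^-1 *: lop k (fun=> alpha).
have cut m n : (m <= n)%N -> (forall k, (m < k)%N -> lop k (fun=> alpha) = 0) ->
    \sum_(1 <= k < n.+1) F k = \sum_(1 <= k < m.+1) F k.
  move=> mn lm; rewrite (big_cat_nat _ (n := m.+1)) //=
    [X in _ + X]big_nat_cond.
  rewrite [X in _ + X]big1 ?addr0 // => k /andP[/andP[mk _] _].
  by rewrite /F lm // scaler0.
have l4 k : (3 < k)%N -> lop k (fun=> alpha) = 0 by move=> k4; rewrite lop_ge4.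
split=> [[_ [n [ln sum0]]]|sum0]; last first.
  split; last by exists 3%N; split.
  by move=> m m0; apply: dsum_in_out.
apply: etrans (esym (cut 3 (maxn n 3) (leq_maxr _ _) l4)) _.
exact: etrans (cut n (maxn n 3) (leq_maxl _ _) ln) sum0.
Qed.

Lemma weak_deformation_maurer_cartan :
  weak_deformation_map Q r <-> maurer_cartan gr lop alpha.
Proof.
rewrite maurer_cartan3; split=> [wd|mc x y].
  apply: dsum_ext => m; have [->|m1] := eqVneq m 1%N.
    apply: multilin_ext => w; rewrite maurer_cartan_coord wd subrr //.
  rewrite coord_sum big1 // => k _; rewrite coordZ.
  rewrite (lop_homog Q (n := fun=> 0%N)); last by move=> _ j;
    exact: dsum_in_out.
  by rewrite big1 // eq_sym (negPf m1) scaler0.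
have /= := maurer_cartan_coord (fun i : 'I_2 => if i == ord0 then x else y).
by rewrite mc => /esym/eqP; rewrite subr_eq0 => /eqP.
Qed.

End Solution.
End MaurerCartan.

Theorem theorem7p1 (K : fieldType) (charK0 : [pchar K] =i pred0)
    (A B : lmodType K) (Q : quasi_twilled A B) :
  exists l : forall k, multilin (bspace A B) (bspace A B) k,
    is_Linfty (dsum_grade (bcomp A B)) l /\
    (forall p (f : bcomp A B p),
       extend (l 1%N (fun=> dsum_in (bcomp A B) p f) (1 + p)%N) =
       bracket (nu_harp Q) (extend f)) /\
    (forall p q (f : bcomp A B p) (g : bcomp A B q),
       extend (l 2%N (fun i => [:: dsum_in (bcomp A B) p f;
                                   dsum_in (bcomp A B) q g]`_i)
                 (1 + p + q)%N) =
       bracket (bracket (mu_tri Q) (extend f)) (extend g)) /\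
    (forall p q s (f : bcomp A B p) (g : bcomp A B q) (h : bcomp A B s),
       extend (l 3%N (fun i => [:: dsum_in (bcomp A B) p f;
                                   dsum_in (bcomp A B) q g;
                                   dsum_in (bcomp A B) s h]`_i)
                 (1 + p + q + s)%N) =
       bracket (bracket (bracket (theta_tilde Q) (extend f)) (extend g))
         (extend h)) /\
    (forall k, (4 <= k)%N -> l k = 0) /\
    (forall r : {linear B -> A},
       weak_deformation_map Q r <->
       maurer_cartan (dsum_grade (bcomp A B)) l
         (dsum_in (bcomp A B) 0 (multilin_of_linear r))).
Proof.
exists (lop Q); split; first exact: lop_Linfty.
split; first by move=> p f; exact: extend_lop1.
split; first by move=> p q f g; exact: extend_lop2.
split; first by move=> p q s f g h; exact: extend_lop3.
split; first by move=> k; exact: lop_ge4.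
by move=> r; exact: weak_deformation_maurer_cartan.
Qed.
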